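(* Let $(M,g_{ab})$ be a connected Einstein pseudo-Riemannian manifold of dimension $n\ge3$ and $Y_{ab}$ a conformal Killing--Yano 2-form on $(M,g_{ab})$ with associated vector field $\xi$. If a non-trivial CKY--RS structure compatible with $Y_{ab}$ exists, with conformal metric $\tilde g=\phi^{-2}g$, $\phi>0$, then there exists a constant $\alpha\in\mathbb{R}$ such that $\mathcal{L}_\xi\phi=\alpha\phi$. Consequently, if the operator $\mathcal{L}_\xi$ (acting on smooth functions) admits no positive non-constant eigenfunction for any real eigenvalue, then $g_{ab}$ admits no non-trivial CKY--RS structure compatible with $Y_{ab}$.
   Context: Einstein: $R_{ab}=\Lambda g_{ab}$ with $\Lambda$ constant. Conformal Killing--Yano (CKY) 2-form: a smooth 2-form $Y_{ab}$ with $\nabla_cY_{ab}=g_{ca}\xi_b-g_{cb}\xi_a+z_{abc}$, where $z_{abc}$ is totally antisymmetric and $\xi_a=\frac{1}{n-1}\nabla^bY_{ba}$; $\xi^a=\xi^a[Y]$ is its associated vector field. CKY--RS structure compatible with $Y$: a function $u\in C^\infty(M)$ and a constant $\lambda\in\mathbb{R}$ such that $\tilde g_{ab}=e^{2u}g_{ab}$ satisfies $\tilde R_{ab}+\frac12\mathcal{L}_{\xi}\tilde g_{ab}=\lambda\tilde g_{ab}$ with $\xi=\xi[Y]$, $\tilde R_{ab}$ being the Ricci tensor of $\tilde g$. It is trivial if $u$ is constant. Here $\phi=e^{-u}$. *)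

(* Defs.v *)
From HB Require Import structures.
From mathcomp Require Import all_boot all_order all_algebra.
From mathcomp Require Import all_classical all_reals all_analysis.

Set Implicit Arguments.
Unset Strict Implicit.
Unset Printing Implicit Defensive.
Import Order.TTheory GRing.Theory Num.Theory.
Import numFieldNormedType.Exports.
Local Open Scope classical_set_scope.
Local Open Scope ring_scope.

Definition partial (R : realType) (n : nat) (a : 'I_n)
    (f : 'rV[R]_n -> R) (x : 'rV[R]_n) : R :=
  'D_(delta_mx 0 a) f x.

(* C^oo on an open set V: every iterated partial derivative exists and is
   (totally) differentiable, hence continuous, at every point of V. *)
Definition smooth_on (R : realType) (n : nat) (V : set 'rV[R]_n)
    (f : 'rV[R]_n -> R) : Prop :=
  forall (s : seq 'I_n) (x : 'rV[R]_n),
    V x -> differentiable (foldr (@partial R n) f s) x.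

(* A smooth manifold of dimension n without boundary, presented by an arbitrary
   smooth atlas.  [param i] is the inverse of the chart map [coord i]; the
   values of [coord i] and [param i] outside [dom i] and [coord i @` dom i]
   are irrelevant. *)
Record smoothManifold (R : realType) (n : nat) := SmoothManifold {
  carrier :> topologicalType ;
  chart : Type ;
  dom : chart -> set carrier ;
  coord : chart -> carrier -> 'rV[R]_n ;
  param : chart -> 'rV[R]_n -> carrier ;
  manifold_hausdorff : hausdorff_space carrier ;
  manifold_second_countable : @second_countable carrier ;
  dom_cover : forall p : carrier, exists i : chart, dom i p ;
  dom_open : forall i : chart, open (dom i) ;
  coord_open : forall i : chart, open (coord i @` dom i) ;
  coordK : forall (i : chart) (p : carrier), dom i p -> param i (coord i p) = p ;
  coord_continuous : forall i : chart, {within dom i, continuous (coord i)} ;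
  param_continuous :
    forall i : chart, {within coord i @` dom i, continuous (param i)} ;
  transition_smooth : forall (i j : chart) (k : 'I_n),
    smooth_on (coord i @` (dom i `&` dom j))
              (fun x => coord j (param i x) 0 k)
}.

Definition chart_image (R : realType) (n : nat) (M : smoothManifold R n)
    (i : chart M) : set 'rV[R]_n :=
  coord i @` dom i.

Definition smooth_fun (R : realType) (n : nat) (M : smoothManifold R n)
    (f : M -> R) : Prop :=
  forall i : chart M, smooth_on (chart_image i) (f \o param i).

Definition nonconstant (R : realType) (n : nat) (M : smoothManifold R n)
    (f : M -> R) : Prop :=
  ~ exists c : R, forall p : M, f p = c.

(* A covariant 2-tensor field on M is given by its component functions
   [T i x a b] = T_ab in each chart i, as functions of the chart coordinates.
   [jacobian] acts on row vectors, so its (a, c) entry is the derivative of the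
   c-th new coordinate with respect to the a-th old one, and the matrix
   equation is the usual law T_ab = (dy^c/dx^a) (dy^d/dx^b) T'_cd. *)
Definition tensor2 (R : realType) (n : nat) (M : smoothManifold R n) : Type :=
  chart M -> 'rV[R]_n -> 'M[R]_n.

Definition smooth_tensor2 (R : realType) (n : nat) (M : smoothManifold R n)
    (T : tensor2 M) : Prop :=
  (forall (i : chart M) (a b : 'I_n),
     smooth_on (chart_image i) (fun x => T i x a b)) /\
  (forall (i j : chart M) (p : M), dom i p -> dom j p ->
     let J := jacobian (fun x => coord j (param i x)) (coord i p) in
     T i (coord i p) = J *m T j (coord j p) *m J^T).

(* On a connected manifold the signature of a nondegenerate symmetric tensor is
   automatically constant. *)
Definition pseudo_riemannian (R : realType) (n : nat) (M : smoothManifold R n)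
    (g : tensor2 M) : Prop :=
  smooth_tensor2 g /\
  forall (i : chart M) (x : 'rV[R]_n), chart_image i x ->
    (g i x)^T = g i x /\ g i x \in unitmx.

Definition two_form (R : realType) (n : nat) (M : smoothManifold R n)
    (Y : tensor2 M) : Prop :=
  smooth_tensor2 Y /\
  forall (i : chart M) (x : 'rV[R]_n), chart_image i x -> (Y i x)^T = - Y i x.

Section LocalGeometry.
Context {R : realType} {n : nat}.
Implicit Types (g T Y : 'rV[R]_n -> 'M[R]_n) (X : 'rV[R]_n -> 'rV[R]_n)
  (f : 'rV[R]_n -> R) (x : 'rV[R]_n) (a b c d e : 'I_n).

(* Gamma^d_ab *)
Definition christoffel g x d a b : R :=
  2^-1 * \sum_e invmx (g x) d e *
    (partial a (fun y => g y e b) x + partial b (fun y => g y e a) x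
     - partial e (fun y => g y a b) x).

(* R^a_bcd, with [nabla_c, nabla_d] V^a = R^a_bcd V^b *)
Definition riemann g x a b c d : R :=
  partial c (fun y => christoffel g y a d b) x
  - partial d (fun y => christoffel g y a c b) x
  + \sum_e (christoffel g x a c e * christoffel g x e d b
            - christoffel g x a d e * christoffel g x e c b).

(* R_bd = R^a_bad, positive on round spheres *)
Definition ricci g x : 'M[R]_n :=
  \matrix_(b, d) \sum_a riemann g x a b a d.

(* nabla_c T_ab *)
Definition nabla2 g T x c a b : R :=
  partial c (fun y => T y a b) x
  - \sum_d (christoffel g x d c a * T x d b + christoffel g x d c b * T x a d).

(* xi_a = (n - 1)^-1 nabla^b Y_ba *)
Definition cky_covector g Y x a : R :=
  (n%:R - 1)^-1 * \sum_b \sum_c invmx (g x) b c * nabla2 g Y x c b a.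

(* xi^a = g^ab xi_b *)
Definition cky_vector g Y x : 'rV[R]_n :=
  \row_a \sum_b invmx (g x) a b * cky_covector g Y x b.

Definition lie_fun X f x : R := \sum_c X x 0 c * partial c f x.

Definition lie_tensor2 X T x : 'M[R]_n :=
  \matrix_(a, b) (lie_fun X (fun y => T y a b) x
    + \sum_c (T x c b * partial a (fun y => X y 0 c) x
              + T x a c * partial b (fun y => X y 0 c) x)).

End LocalGeometry.

Definition totally_antisymmetric (R : realType) (n : nat)
    (z : 'I_n -> 'I_n -> 'I_n -> R) : Prop :=
  forall a b c : 'I_n, z b a c = - z a b c /\ z a c b = - z a b c.

Definition einstein (R : realType) (n : nat) (M : smoothManifold R n)
    (g : tensor2 M) : Prop :=
  exists Lambda : R, forall (i : chart M) (x : 'rV[R]_n), chart_image i x ->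
    ricci (g i) x = Lambda *: g i x.

(* z is determined by the equation, so that choosing it chart by chart and point
   by point still yields a smooth 3-form. *)
Definition conformal_killing_yano (R : realType) (n : nat)
    (M : smoothManifold R n) (g Y : tensor2 M) : Prop :=
  two_form Y /\
  forall (i : chart M) (x : 'rV[R]_n), chart_image i x ->
    exists2 z : 'I_n -> 'I_n -> 'I_n -> R, totally_antisymmetric z &
      forall a b c : 'I_n,
        nabla2 (g i) (Y i) x c a b =
          g i x c a * cky_covector (g i) (Y i) x b
          - g i x c b * cky_covector (g i) (Y i) x a + z a b c.

(* The index of [xi] in [xi[Y]] is raised with g, not with e^(2u) g. *)
Definition cky_field (R : realType) (n : nat) (M : smoothManifold R n)
    (g Y : tensor2 M) (i : chart M) (x : 'rV[R]_n) : 'rV[R]_n :=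
  cky_vector (g i) (Y i) x.

Definition conformal_metric (R : realType) (n : nat) (M : smoothManifold R n)
    (g : tensor2 M) (u : M -> R) : tensor2 M :=
  fun i x => expR (2 * u (param i x)) *: g i x.

Definition cky_rs (R : realType) (n : nat) (M : smoothManifold R n)
    (g Y : tensor2 M) (u : M -> R) (lambda : R) : Prop :=
  smooth_fun u /\
  forall (i : chart M) (x : 'rV[R]_n), chart_image i x ->
    let gt := conformal_metric g u i in
    ricci gt x + 2^-1 *: lie_tensor2 (cky_field g Y i) gt x = lambda *: gt x.

(* L_xi f = alpha f, expressed in every chart. *)
Definition lie_eigen (R : realType) (n : nat) (M : smoothManifold R n)
    (xi : chart M -> 'rV[R]_n -> 'rV[R]_n) (f : M -> R) (alpha : R) : Prop :=
  forall (i : chart M) (p : M), dom i p ->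
    lie_fun (xi i) (f \o param i) (coord i p) = alpha * f p.

(* Main.v *)
(* Idea.  On an Einstein manifold the vector field xi of a CKY 2-form is Killing:
   contract the derivative of the CKY equation, symmetrized so as to eliminate
   z, and use the Ricci identity.  Hence, writing phi = e^(-u), the trace-free
   part of the soliton equation is the trace-free part of Nabla d phi = 0; in
   terms of u it reads Nabla du = du (x) du + chi g for a function chi.
   Differentiating once more, (n - 1)(d chi - chi du) = - Lambda du.  The trace
   of the soliton equation is
     (xi u - lambda) e^(2u) = (2n - 2) chi + (n - 1) |du|^2 - Lambda,
   and the derivative of the right-hand side W is 2 W du, so d(xi u) = 0 and
   xi phi = - (xi u) phi with xi u locally constant.

   The transformation law of the Christoffel symbols is never needed to compare
   two charts: |du|^2 is an invariant first-order expression, and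
   d|du|^2 = 2 (|du|^2 + chi) du determines chi, hence xi u, where du <> 0,
   whereas xi u = 0 where du = 0. *)

Require Import Defs.
From HB Require Import structures.
From mathcomp Require Import all_boot all_order all_algebra.
From mathcomp Require Import all_classical all_reals all_analysis.
From mathcomp Require Import ring lra.
Set Implicit Arguments.
Unset Strict Implicit.
Unset Printing Implicit Defensive.
Import Order.TTheory GRing.Theory Num.Theory.
Import numFieldNormedType.Exports.
Local Open Scope classical_set_scope.
Local Open Scope ring_scope.

(* Again, so that [coord] is the chart map and not [vector.coord]. *)
Import Defs.

(** * Smooth functions on open sets of R^n *)

(** Most of the tensor identities are proved in one chart and in two layers: an algebraic statement
    about finite families of reals, where partial derivatives are independent unknowns tied only by
    the product rule, and its instance at a point. In the Killing step the commutator of covariant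
    derivatives on [Y] leaves a curvature term, and the difficulty is to see that it is skew in its
    two free indices. Its Riemann part is skew by pair symmetry; its Ricci part is skew because the
    Einstein equation reduces it to a multiple of [Y]. Adding the transpose removes both and leaves
    an equation for the symmetric part of nabla xi alone, which for n >= 3 has only the zero
    solution. In the Hessian step the Einstein equation acts again: contracting the Ricci identity
    for the gradient of [u] turns curvature into Lambda du. *)

Lemma near_eq_differentiable (R : realType) (U W : normedModType R)
    (f h : U -> W) x :
  (\near x, f x = h x) -> differentiable f x -> differentiable h x.
Proof.
move=> fh df; have fhx : f x = h x by exact: (nbhs_singleton fh).
have [dfc dfE] := (diff_locallyP _ _).1 df.
(* The first-order expansion of [f] at [x] holds for [h] as well, and uniqueness of the differential
   concludes. *)
have hE : h \o shift x = cst (h x) + 'd f x +o_ 0 id.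
  move/eqaddoP : dfE => dfE; apply/eqaddoP => e e0.
  have fh0 : \forall z \near 0, f (z + x) = h (z + x).
    by move: fh; rewrite (near_shift 0 x); apply: filterS => z; rewrite /= subr0.
  apply: filterS2 fh0 (dfE _ e0) => y fhy.
  by rewrite !fctE /= -fhy -fhx.
apply/diff_locallyP.
by rewrite (diff_unique dfc hE); split.
Qed.

Section SmoothFunctions.
Context {R : realType} {n : nat}.
Implicit Types (f h : 'rV[R]_n -> R) (V : set 'rV[R]_n) (x : 'rV[R]_n).

Lemma partial_ext V f h a x : open V -> V x -> (forall y, V y -> f y = h y) ->
  partial a f x = partial a h x.
Proof.
move=> oV Vx fh; apply: near_eq_derive.
by apply: filterS (open_nbhs_nbhs (conj oV Vx)).
Qed.

Lemma differentiable_ext V f h x : open V -> V x ->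
  (forall y, V y -> f y = h y) -> differentiable f x -> differentiable h x.
Proof.
move=> oV Vx fh; apply: near_eq_differentiable.
by apply: filterS (open_nbhs_nbhs (conj oV Vx)).
Qed.

Lemma partial_cst (c : R) a x : partial a (fun=> c) x = 0.
Proof. exact: derive_cst. Qed.

Lemma partialD f h a x : differentiable f x -> differentiable h x ->
  partial a (fun y => f y + h y) x = partial a f x + partial a h x.
Proof. by move=> df dh; apply: deriveD; exact: diff_derivable. Qed.

Lemma partialN f a x : differentiable f x ->
  partial a (fun y => - f y) x = - partial a f x.
Proof. by move=> df; apply: deriveN; exact: diff_derivable. Qed.

Lemma partialM f h a x : differentiable f x -> differentiable h x ->
  partial a (fun y => f y * h y) x = partial a f x * h x + f x * partial a h x.
Proof.
move=> df dh; rewrite /partial (deriveM (diff_derivable df) (diff_derivable dh)).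
by rewrite addrC /= mulrC.
Qed.

Lemma partialZ (k : R) f a x : differentiable f x ->
  partial a (fun y => k * f y) x = k * partial a f x.
Proof.
move=> df; rewrite (partialM _ (differentiable_cst k x) df) partial_cst.
by rewrite mul0r add0r.
Qed.

Lemma partial_comp (phi : R -> R) f a x :
  differentiable f x -> derivable phi (f x) 1 ->
  partial a (fun y => phi (f y)) x = phi^`()%classic (f x) * partial a f x.
Proof.
move=> df dphi; have dphi' := (derivable1_diffP _ _).1 dphi.
rewrite /partial !deriveE//; last exact: differentiable_comp.
rewrite (diff_comp df dphi') /= derive1E' //.
by rewrite -[X in 'd _ _ X = _]mulr1 linearZ mulrC.
Qed.

Lemma differentiable_bigsum (I : Type) (r : seq I) (P : pred I)
    (F : I -> 'rV[R]_n -> R) x :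
  (forall i, differentiable (F i) x) ->
  differentiable (fun y => \sum_(i <- r | P i) F i y) x.
Proof.
move=> dF; elim: r => [|i r IH].
  by under eq_fun do rewrite big_nil; exact: differentiable_cst.
under eq_fun do rewrite big_cons.
by case: (P i) => //; exact: differentiableD.
Qed.

Lemma partial_sum (I : Type) (r : seq I) (P : pred I)
    (F : I -> 'rV[R]_n -> R) a x :
  (forall i, differentiable (F i) x) ->
  partial a (fun y => \sum_(i <- r | P i) F i y) x
  = \sum_(i <- r | P i) partial a (F i) x.
Proof.
move=> dF; elim: r => [|i r IH].
  by under eq_fun do rewrite big_nil; rewrite big_nil partial_cst.
under eq_fun do rewrite big_cons.
rewrite big_cons; case: (P i) => //; rewrite partialD ?IH//.
exact: differentiable_bigsum.
Qed.

(** Smoothness truncated at order [k]. The grading makes closure under products provable by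
    induction: a derivative of [f * h] involves [f] and [h] themselves next to their derivatives,
    and all of these are available at the smaller order. *)
Fixpoint diff_upto k V f : Prop :=
  (forall x, V x -> differentiable f x) /\
  (if k is k'.+1 then forall a, diff_upto k' V (partial a f) else True).

(** [foldr] applies the last index of the list first, so the innermost derivative is peeled off with
    [rcons]. *)
Lemma smooth_onE V f :
  smooth_on V f <-> (forall x, V x -> differentiable f x) /\
                    forall a, smooth_on V (partial a f).
Proof.
split=> [sf|[df sf]].
  split=> [x Vx|a s x Vx]; first exact: (sf [::]).
  by have := sf (rcons s a) x Vx; rewrite foldr_rcons.
move=> s; case/lastP: s => [|s a] x Vx; first exact: df.
by rewrite foldr_rcons; exact: sf.
Qed.

Lemma smooth_on_upto V f : smooth_on V f <-> forall k, diff_upto k V f.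
Proof.
split=> [sf k|].
  elim: k f sf => [|k IH] f /smooth_onE [df sf] //.
  by split=> // a; exact: IH.
move=> + s; elim/last_ind: s f => [|s a IH] f kf x Vx.
  by case: (kf 0%N) => + _; apply.
by rewrite foldr_rcons; apply: IH => // k; have [_] := kf k.+1; apply.
Qed.

Lemma diff_uptoS k V f : diff_upto k.+1 V f -> diff_upto k V f.
Proof.
elim: k f => [|k IH] f [df sf]; first by split.
by split=> // a; exact: IH.
Qed.

Lemma diff_upto_ext k V f h : open V -> (forall y, V y -> f y = h y) ->
  diff_upto k V f -> diff_upto k V h.
Proof.
move=> oV; elim: k f h => [|k IH] f h fh [df sf]; split=> //.
- by move=> x Vx; exact: (differentiable_ext oV Vx fh (df _ Vx)).
- by move=> x Vx; exact: (differentiable_ext oV Vx fh (df _ Vx)).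
by move=> a; apply: IH (sf a) => y Vy; exact: partial_ext oV Vy fh.
Qed.

Lemma diff_upto_cst k V (c : R) : diff_upto k V (fun=> c).
Proof.
elim: k c => [|k IH] c; first by split=> // x _; exact: differentiable_cst.
split=> [x _|a]; first exact: differentiable_cst.
by rewrite (_ : partial a _ = fun=> 0) //; apply/funext => x; exact: partial_cst.
Qed.

Lemma diff_uptoD k V f h : open V -> diff_upto k V f -> diff_upto k V h ->
  diff_upto k V (fun y => f y + h y).
Proof.
move=> oV; elim: k f h => [|k IH] f h [df sf] [dh sh].
  by split=> // x Vx; exact: differentiableD (df _ Vx) (dh _ Vx).
split=> [x Vx|a]; first exact: differentiableD (df _ Vx) (dh _ Vx).
apply: (diff_upto_ext oV _ (IH _ _ (sf a) (sh a))) => y Vy.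
by rewrite partialD//; [exact: df|exact: dh].
Qed.

Lemma diff_uptoM k V f h : open V -> diff_upto k V f -> diff_upto k V h ->
  diff_upto k V (fun y => f y * h y).
Proof.
move=> oV; elim: k f h => [|k IH] f h kf kh.
  case: kf kh => df _ [dh _]; split=> // x Vx.
  exact: differentiableM (df _ Vx) (dh _ Vx).
have [df sf] := kf; have [dh sh] := kh.
split=> [x Vx|a]; first exact: differentiableM (df _ Vx) (dh _ Vx).
have kd := diff_uptoD oV (IH _ _ (sf a) (diff_uptoS kh))
  (IH _ _ (diff_uptoS kf) (sh a)).
apply: (diff_upto_ext oV _ kd) => y Vy.
by rewrite partialM//; [exact: df|exact: dh].
Qed.

Lemma diff_uptoV k V f : open V -> (forall x, V x -> f x != 0) ->
  diff_upto k V f -> diff_upto k V (fun y => (f y)^-1).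
Proof.
move=> oV f0; elim: k f f0 => [|k IH] f f0 kf.
  case: kf => df _; split=> // x Vx.
  exact: differentiableV (df _ Vx) (f0 _ Vx).
have [df sf] := kf.
split=> [x Vx|a]; first exact: differentiableV (df _ Vx) (f0 _ Vx).
have kV := IH _ f0 (diff_uptoS kf).
(* The derivative of the inverse, written as a product of the constant -1, the derivative of [f] and
   two copies of the inverse; the induction hypothesis covers the copies. *)
have kd := diff_uptoM oV (diff_uptoM oV (diff_upto_cst k V (-1)) (sf a))
  (diff_uptoM oV kV kV).
apply: (diff_upto_ext oV _ kd) => y Vy.
rewrite /partial [RHS](deriveV (f0 _ Vy) (diff_derivable (df _ Vy))).
rewrite /GRing.scale /= expr2 invfM; ring.
Qed.

Lemma diff_upto_exp k V f : open V ->
  diff_upto k V f -> diff_upto k V (fun y => expR (f y)).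
Proof.
move=> oV; elim: k f => [|k IH] f kf; have [df sf] := kf.
  split=> // x Vx.
  apply: differentiable_comp (df _ Vx) _.
  exact/derivable1_diffP/derivable_expR.
split=> [x Vx|a].
  apply: differentiable_comp (df _ Vx) _.
  exact/derivable1_diffP/derivable_expR.
have kd := diff_uptoM oV (IH _ (diff_uptoS kf)) (sf a).
apply: (diff_upto_ext oV _ kd) => y Vy.
by rewrite (partial_comp _ (df _ Vy) (@derivable_expR R (f y))) derive1E derive_val.
Qed.

Section Closure.
Variable V : set 'rV[R]_n.
Hypothesis oV : open V.

Lemma smooth_on_diff f x : smooth_on V f -> V x -> differentiable f x.
Proof. by move=> sf Vx; exact: (sf [::]). Qed.

Lemma smooth_on_partial f a : smooth_on V f -> smooth_on V (partial a f).
Proof. by move=> /smooth_onE[]. Qed.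

Lemma smooth_on_ext f h : (forall y, V y -> f y = h y) ->
  smooth_on V f -> smooth_on V h.
Proof.
move=> fh /smooth_on_upto sf; apply/smooth_on_upto => k.
exact: diff_upto_ext fh (sf k).
Qed.

Lemma smooth_on_cst (c : R) : smooth_on V (fun=> c).
Proof. by apply/smooth_on_upto => k; exact: diff_upto_cst. Qed.

Lemma smooth_onD f h : smooth_on V f -> smooth_on V h ->
  smooth_on V (fun y => f y + h y).
Proof.
move=> /smooth_on_upto sf /smooth_on_upto sh; apply/smooth_on_upto => k.
exact: diff_uptoD.
Qed.

Lemma smooth_onM f h : smooth_on V f -> smooth_on V h ->
  smooth_on V (fun y => f y * h y).
Proof.
move=> /smooth_on_upto sf /smooth_on_upto sh; apply/smooth_on_upto => k.
exact: diff_uptoM.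
Qed.

Lemma smooth_onV f : (forall x, V x -> f x != 0) -> smooth_on V f ->
  smooth_on V (fun y => (f y)^-1).
Proof.
move=> f0 /smooth_on_upto sf; apply/smooth_on_upto => k.
exact: diff_uptoV.
Qed.

Lemma smooth_on_exp f : smooth_on V f -> smooth_on V (fun y => expR (f y)).
Proof.
move=> /smooth_on_upto sf; apply/smooth_on_upto => k.
exact: diff_upto_exp.
Qed.

Lemma smooth_onN f : smooth_on V f -> smooth_on V (fun y => - f y).
Proof.
move=> sf; have := smooth_onM (smooth_on_cst (-1)) sf.
by under eq_fun do rewrite mulN1r.
Qed.

Lemma smooth_onB f h : smooth_on V f -> smooth_on V h ->
  smooth_on V (fun y => f y - h y).
Proof. by move=> sf sh; apply: smooth_onD => //; exact: smooth_onN. Qed.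

Lemma smooth_on_sum (I : Type) (r : seq I) (P : pred I)
    (F : I -> 'rV[R]_n -> R) : (forall i, smooth_on V (F i)) ->
  smooth_on V (fun y => \sum_(i <- r | P i) F i y).
Proof.
move=> sF; elim: r => [|i r IH].
  by under eq_fun do rewrite big_nil; exact: smooth_on_cst.
under eq_fun do rewrite big_cons.
by case: (P i) => //; exact: smooth_onD.
Qed.

Lemma smooth_on_prod (I : Type) (r : seq I) (P : pred I)
    (F : I -> 'rV[R]_n -> R) : (forall i, smooth_on V (F i)) ->
  smooth_on V (fun y => \prod_(i <- r | P i) F i y).
Proof.
move=> sF; elim: r => [|i r IH].
  by under eq_fun do rewrite big_nil; exact: smooth_on_cst.
under eq_fun do rewrite big_cons.
by case: (P i) => //; exact: smooth_onM.
Qed.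

Lemma smooth_on_det m (F : 'rV[R]_n -> 'M[R]_m) :
  (forall i j, smooth_on V (fun y => F y i j)) ->
  smooth_on V (fun y => \det (F y)).
Proof.
move=> sF; apply: smooth_on_sum => s.
apply: smooth_onM; first exact: smooth_on_cst.
by apply: smooth_on_prod => i; exact: sF.
Qed.

(** Cramer's rule: adjugate over determinant, both polynomial in the entries. *)
Lemma smooth_on_invmx m (F : 'rV[R]_n -> 'M[R]_m) i j :
  (forall i j, smooth_on V (fun y => F y i j)) ->
  (forall y, V y -> F y \in unitmx) ->
  smooth_on V (fun y => invmx (F y) i j).
Proof.
move=> sF uF.
have s : smooth_on V (fun y => (\det (F y))^-1 * \adj (F y) i j).
  apply: smooth_onM.
    apply: smooth_onV; last exact: smooth_on_det.
    by move=> x Vx; rewrite -unitfE; exact: uF.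
  under eq_fun do rewrite mxE; apply: smooth_onM; first exact: smooth_on_cst.
  by apply: smooth_on_det => k l; under eq_fun do rewrite !mxE; exact: sF.
by apply: (smooth_on_ext _ s) => y Vy; rewrite /invmx uF// [RHS]mxE.
Qed.

End Closure.
End SmoothFunctions.

(** * Symmetry of second derivatives and local constancy, by the mean value theorem *)

Section MixedPartials.
Context {R : realType} {n : nat}.
Implicit Types (f h : 'rV[R]_n -> R) (V : set 'rV[R]_n) (x v w : 'rV[R]_n).

Lemma is_derive_line f x v (t : R) : differentiable f (x + t *: v) ->
  is_derive t 1 (fun s => f (x + s *: v)) ('D_v f (x + t *: v)).
Proof.
move=> df.
have dl : is_diff t (fun s : R => x + s *: v) (fun s => s *: v).
  have := is_diffD (is_diff_cst x t) (is_diff_scalel t v).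
  by rewrite add0r.
have ddl : differentiable (fun s : R => x + s *: v) t by exact: ex_diff.
have dc := differentiable_comp ddl df.
apply: DeriveDef; first exact/derivable1_diffP.
by rewrite !deriveE // (diff_comp ddl df) /= diff_val scale1r.
Qed.

Lemma segment_MVT f x v (t : R) : 0 < t ->
  (forall s, 0 <= s <= t -> differentiable f (x + s *: v)) ->
  exists2 s, 0 <= s <= t & f (x + t *: v) - f x = 'D_v f (x + s *: v) * t.
Proof.
move=> t0 df.
have D s : s \in `]0, t[%R ->
    is_derive s 1 (fun s => f (x + s *: v)) ('D_v f (x + s *: v)).
  rewrite in_itv /= => /andP[s0 st]; apply: is_derive_line.
  by apply: df; rewrite !ltW.
have C : {within `[0, t], continuous (fun s => f (x + s *: v))}.
  apply: continuous_in_subspaceT => s; rewrite inE /= in_itv /= => s0t.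
  have [/derivable1_diffP ds _] := is_derive_line (df s s0t).
  exact: differentiable_continuous.
have [s] := MVT t0 D C.
rewrite in_itv /= => /andP[s0 st]; rewrite scale0r addr0 subr0 => E.
by exists s => //; rewrite !ltW.
Qed.

Lemma derive_eq0_segment_const f x v :
  (forall s : R, 0 <= s <= 1 -> differentiable f (x + s *: v)) ->
  (forall s : R, 0 <= s <= 1 -> 'D_v f (x + s *: v) = 0) ->
  f (x + v) = f x.
Proof.
move=> df d0; have [s s01] := segment_MVT ltr01 df.
by rewrite d0// mul0r scale1r => /eqP; rewrite subr_eq0 => /eqP.
Qed.

Lemma derive_translate f x v w :
  'D_v (fun y => f (y + w)) x = 'D_v f (x + w).
Proof.
rewrite /derive; set g1 := fun h : R => _; set g2 := fun h : R => _.
by suff -> : g1 = g2 by []; apply/funext => s; rewrite /g1 /g2 /= addrA.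
Qed.

(** The second difference over the parallelogram spanned by [t *: v] and [t *: w] is symmetric in
    [v] and [w]. Two mean value steps, for [F] along [v] and then for ['D_v f] along [w], turn it
    into a mixed derivative at a point of the parallelogram. *)
Lemma second_difference_MVT f x v w (t : R) : 0 < t ->
  (forall r s, 0 <= r <= t -> 0 <= s <= t ->
     differentiable f (x + r *: v + s *: w)) ->
  (forall r s, 0 <= r <= t -> 0 <= s <= t ->
     differentiable ('D_v f) (x + r *: v + s *: w)) ->
  exists r s, [/\ 0 <= r <= t, 0 <= s <= t &
    f (x + t *: v + t *: w) - (f (x + t *: v) + f (x + t *: w)) + f x
    = 'D_w ('D_v f) (x + r *: v + s *: w) * t * t].
Proof.
move=> t0 df ddf.
have t00 : 0 <= (0 : R) <= t by rewrite lexx ltW.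
have tt : 0 <= t <= t by rewrite lexx andbT ltW.
pose F := fun y => f (y + t *: w) - f y.
have dsh y : differentiable (fun z : 'rV[R]_n => z + t *: w) y.
  exact: differentiableD.
have dft r : 0 <= r <= t -> differentiable (fun y => f (y + t *: w)) (x + r *: v).
  move=> r0t; apply: (@differentiable_comp _ _ _ _ (fun z : 'rV[R]_n => z + t *: w)).
    exact: dsh.
  exact: df.
have dfr r : 0 <= r <= t -> differentiable f (x + r *: v).
  by move=> r0t; have := df r 0 r0t t00; rewrite scale0r addr0.
have dF r : 0 <= r <= t -> differentiable F (x + r *: v).
  by move=> r0t; apply: differentiableB; [exact: dft|exact: dfr].
have [r r0t E] := segment_MVT t0 dF.
have [s s0t E'] := segment_MVT t0 (fun s => @ddf r s r0t).
exists r, s; split=> //; rewrite -E'.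
have -> : 'D_v f (x + r *: v + t *: w) - 'D_v f (x + r *: v)
    = 'D_v F (x + r *: v).
  rewrite /F [RHS]deriveB; [|exact/diff_derivable/dft|exact/diff_derivable/dfr].
  by rewrite derive_translate.
move: E; rewrite /F => <-.
set f1 := f (_ + _ + _); set f2 := f _; set f3 := f _; set f4 := f _.
ring.
Qed.

Lemma ball_continuous_pair V f h x (e : R) : open V -> V x ->
  {for x, continuous f} -> {for x, continuous h} -> 0 < e ->
  exists2 d : R, 0 < d & forall y, ball x d y ->
    [/\ V y, `|f x - f y| <= e & `|h x - h y| <= e].
Proof.
move=> oV Vx cf ch e0.
have /cvgrPdist_le /(_ _ e0) nf := cf.
have /cvgrPdist_le /(_ _ e0) nh := ch.
have nV := open_nbhs_nbhs (conj oV Vx).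
apply/nbhs_ballP.
by near=> y; split; near: y; [exact: nV|exact: nf|exact: nh].
Unshelve. all: by end_near. Qed.

Lemma ler_dist_common (p q p' q' d e : R) : p' = q' ->
  `|p - p'| <= d -> `|q - q'| <= e -> `|p - q| <= d + e.
Proof.
move=> <- pd qe; have -> : p - q = (p - p') - (q - p') by ring.
by apply: le_trans (ler_normB _ _) _; exact: lerD.
Qed.

(** Schwarz's theorem: one second difference equals [t * t] times either mixed derivative, each
    taken at a point near [x], and continuity of both bounds their gap at [x] by every [e > 0]. *)
Lemma derive_commute V f x v w : open V -> V x ->
  (forall y, V y -> differentiable f y) ->
  (forall y, V y -> differentiable ('D_v f) y) ->
  (forall y, V y -> differentiable ('D_w f) y) ->
  {for x, continuous ('D_w ('D_v f))} -> {for x, continuous ('D_v ('D_w f))} ->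
  'D_w ('D_v f) x = 'D_v ('D_w f) x.
Proof.
move=> oV Vx df dv dw cvw cwv.
apply/eqP; rewrite -subr_eq0 -normr_le0; apply/ler_addgt0Pl => e e0; rewrite addr0.
have e20 : 0 < e / 2 by rewrite divr_gt0.
have [d d0 dP] := ball_continuous_pair oV Vx cvw cwv e20.
(* With [t = d / 2 / k] every displacement has norm at most [t * k = d / 2]; the summand 1 keeps [k]
   positive when both vectors vanish. *)
pose k := 1 + `|v| + `|w|.
have k0 : 0 < k by rewrite /k -addrA ltr_pwDl// addr_ge0.
pose t := d / 2 / k.
have t0 : 0 < t by rewrite /t !divr_gt0.
have B r s : 0 <= r <= t -> 0 <= s <= t -> ball x d (x + r *: v + s *: w).
  move=> /andP[r0 rt] /andP[s0 st].
  rewrite -ball_normE /= -addrA opprD addrA subrr add0r normrN.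
  apply: le_lt_trans (ler_normD _ _) _.
  rewrite !normrZ !ger0_norm//.
  apply: (@le_lt_trans _ _ (t * k)).
    rewrite /k !mulrDr mulr1 -addrA.
    apply: (@le_trans _ _ (t * `|v| + t * `|w|)).
      by rewrite lerD// ler_wpM2r.
    by rewrite lerDr ltW.
  by rewrite /t divfK ?gt_eqF// ltr_pdivrMr// ltr_pMr// ltr1n.
have B' r s : 0 <= r <= t -> 0 <= s <= t -> ball x d (x + r *: w + s *: v).
  by move=> *; rewrite addrAC; exact: B.
have [||r1 [s1 [r1t s1t E1]]] := @second_difference_MVT f x v w t t0.
- by move=> r s r0 s0; apply: df; have [] := dP _ (B r s r0 s0).
- by move=> r s r0 s0; apply: dv; have [] := dP _ (B r s r0 s0).
have [||r2 [s2 [r2t s2t E2]]] := @second_difference_MVT f x w v t t0.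
- by move=> r s r0 s0; apply: df; have [] := dP _ (B' r s r0 s0).
- by move=> r s r0 s0; apply: dw; have [] := dP _ (B' r s r0 s0).
have cancel_t p q : p * t * t = q * t * t -> p = q.
  by move=> /(mulIf (lt0r_neq0 t0)) /(mulIf (lt0r_neq0 t0)).
rewrite [x + t *: v + t *: w]addrAC [f (x + t *: v) + _]addrC in E1.
have E := cancel_t _ _ (etrans (esym E1) E2).
have [_ N1 _] := dP _ (B _ _ r1t s1t).
have [_ _ N2] := dP _ (B' _ _ r2t s2t).
by rewrite (splitr e); exact: ler_dist_common E N1 N2.
Qed.

Lemma partial_commute V f a b x : open V -> smooth_on V f -> V x ->
  partial a (partial b f) x = partial b (partial a f) x.
Proof.
move=> oV sf Vx; apply: (derive_commute oV Vx).
- by move=> y Vy; exact: (sf [::]).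
- by move=> y Vy; exact: (sf [:: b]).
- by move=> y Vy; exact: (sf [:: a]).
- exact/differentiable_continuous/(sf [:: a; b]).
- exact/differentiable_continuous/(sf [:: b; a]).
Qed.

Lemma deriveE_partial f x v : differentiable f x ->
  'D_v f x = \sum_a v 0 a * partial a f x.
Proof.
move=> df; rewrite deriveE// {1}(row_sum_delta v) linear_sum.
by apply: eq_bigr => a _; rewrite linearZ /partial deriveE.
Qed.

Lemma near_const_of_partial0 V f x : open V -> V x ->
  (forall y, V y -> differentiable f y) ->
  (forall a y, V y -> partial a f y = 0) ->
  \forall y \near x, V y /\ f y = f x.
Proof.
move=> oV Vx df d0.
have [d /= d0' dP] := (nbhs_ballP _ _).1 (open_nbhs_nbhs (conj oV Vx)).
apply/nbhs_ballP; exists d => //= y By; split; first exact: dP.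
have B s : 0 <= s <= 1 -> V (x + s *: (y - x)).
  move=> /andP[s0 s1]; apply: dP.
  move: By; rewrite -!ball_normE /= opprD addrA subrr add0r normrN normrZ.
  by rewrite ger0_norm// distrC; apply: le_lt_trans; rewrite ler_piMl.
have := @derive_eq0_segment_const f x (y - x); rewrite subrKC; apply.
  by move=> s /B /df.
move=> s /B Vs; rewrite deriveE_partial; last exact: df.
by rewrite big1// => a _; rewrite d0// mulr0.
Qed.

End MixedPartials.

(** * The Levi-Civita connection in matrix form *)

(* Sealed, so that failed unifications of tensor components stop here instead of
   unfolding the limits behind [partial]. *)
HB.lock Definition mpartial (R : realType) (n p q : nat) (c : 'I_n)
    (F : 'rV[R]_n -> 'M[R]_(p, q)) (x : 'rV[R]_n) : 'M[R]_(p, q) :=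
  \matrix_(i, j) partial c (fun y => F y i j) x.

(** Rows carry the lower index and columns the upper one, so that the connection acts on a covariant
    2-tensor [T] through [Gam *m T] and [T *m Gam^T], and on a row vector by right
    multiplication. *)
HB.lock Definition Gam (R : realType) (n : nat) (g : 'rV[R]_n -> 'M[R]_n)
    (c : 'I_n) (x : 'rV[R]_n) : 'M[R]_n :=
  \matrix_(a, d) christoffel g x d c a.

HB.lock Definition Om (R : realType) (n : nat) (g : 'rV[R]_n -> 'M[R]_n)
    (c d : 'I_n) (x : 'rV[R]_n) : 'M[R]_n :=
  \matrix_(b, a) riemann g x a b c d.

Lemma mpartialE (R : realType) n p q c (F : 'rV[R]_n -> 'M[R]_(p, q)) x i j :
  mpartial c F x i j = partial c (fun y => F y i j) x.
Proof. by rewrite mpartial.unlock mxE. Qed.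

Lemma GamE (R : realType) n (g : 'rV[R]_n -> 'M[R]_n) c x a d :
  Gam g c x a d = christoffel g x d c a.
Proof. by rewrite Gam.unlock mxE. Qed.

Lemma Om_riemann (R : realType) n (g : 'rV[R]_n -> 'M[R]_n) c d x a b :
  Om g c d x b a = riemann g x a b c d.
Proof. by rewrite Om.unlock mxE. Qed.

Section MatrixCalculus.
Context {R : realType} {n : nat}.
Variable V : set 'rV[R]_n.
Hypothesis oV : open V.

Definition smooth_mx p q (F : 'rV[R]_n -> 'M[R]_(p, q)) : Prop :=
  forall i j, smooth_on V (fun y => F y i j).

Lemma smooth_mx_diff p q (F : 'rV[R]_n -> 'M[R]_(p, q)) x i j :
  smooth_mx F -> V x -> differentiable (fun y => F y i j) x.
Proof. by move=> sF; exact: smooth_on_diff. Qed.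

Lemma smooth_mxM p q r (F : 'rV[R]_n -> 'M[R]_(p, q))
    (H : 'rV[R]_n -> 'M[R]_(q, r)) :
  smooth_mx F -> smooth_mx H -> smooth_mx (fun y => F y *m H y).
Proof.
move=> sF sH i j; under eq_fun do rewrite mxE.
by apply: smooth_on_sum => // k; exact: smooth_onM.
Qed.

Lemma smooth_mxD p q (F H : 'rV[R]_n -> 'M[R]_(p, q)) :
  smooth_mx F -> smooth_mx H -> smooth_mx (fun y => F y + H y).
Proof.
by move=> sF sH i j; under eq_fun do rewrite mxE; exact: smooth_onD.
Qed.

Lemma smooth_mxN p q (F : 'rV[R]_n -> 'M[R]_(p, q)) :
  smooth_mx F -> smooth_mx (fun y => - F y).
Proof. by move=> sF i j; under eq_fun do rewrite mxE; exact: smooth_onN. Qed.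

Lemma smooth_mxT p q (F : 'rV[R]_n -> 'M[R]_(p, q)) :
  smooth_mx F -> smooth_mx (fun y => (F y)^T).
Proof. by move=> sF i j; under eq_fun do rewrite mxE; exact: sF. Qed.

Lemma smooth_mx_mpartial p q c (F : 'rV[R]_n -> 'M[R]_(p, q)) :
  smooth_mx F -> smooth_mx (mpartial c F).
Proof.
by move=> sF i j; under eq_fun do rewrite mpartialE; exact/smooth_on_partial/sF.
Qed.

Lemma mpartial_ext p q c (F H : 'rV[R]_n -> 'M[R]_(p, q)) x :
  V x -> (forall y, V y -> F y = H y) -> mpartial c F x = mpartial c H x.
Proof.
move=> Vx FH; apply/matrixP => i j; rewrite !mpartialE.
by apply: (partial_ext _ oV Vx) => y /FH ->.
Qed.

Lemma mpartial_cst p q c (A : 'M[R]_(p, q)) (x : 'rV[R]_n) : mpartial c (fun=> A) x = 0.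
Proof. by apply/matrixP => i j; rewrite mpartialE partial_cst mxE. Qed.

Lemma mpartialD p q c (F H : 'rV[R]_n -> 'M[R]_(p, q)) x :
  smooth_mx F -> smooth_mx H -> V x ->
  mpartial c (fun y => F y + H y) x = mpartial c F x + mpartial c H x.
Proof.
move=> sF sH Vx; apply/matrixP => i j; rewrite mxE !mpartialE.
by under eq_fun do rewrite mxE; rewrite partialD//; exact: smooth_mx_diff.
Qed.

Lemma mpartialN p q c (F : 'rV[R]_n -> 'M[R]_(p, q)) x :
  smooth_mx F -> V x -> mpartial c (fun y => - F y) x = - mpartial c F x.
Proof.
move=> sF Vx; apply/matrixP => i j; rewrite mxE !mpartialE.
by under eq_fun do rewrite mxE; rewrite partialN//; exact: smooth_mx_diff.
Qed.

Lemma mpartialT p q c (F : 'rV[R]_n -> 'M[R]_(p, q)) x :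
  mpartial c (fun y => (F y)^T) x = (mpartial c F x)^T.
Proof.
by apply/matrixP => i j; rewrite mxE !mpartialE; under eq_fun do rewrite mxE.
Qed.

Lemma mpartialM p q r c (F : 'rV[R]_n -> 'M[R]_(p, q))
    (H : 'rV[R]_n -> 'M[R]_(q, r)) x :
  smooth_mx F -> smooth_mx H -> V x ->
  mpartial c (fun y => F y *m H y) x
  = mpartial c F x *m H x + F x *m mpartial c H x.
Proof.
move=> sF sH Vx; apply/matrixP => i j; rewrite mpartialE !mxE.
under eq_fun do rewrite mxE.
rewrite partial_sum; last first.
  by move=> k; apply: differentiableM; exact: smooth_mx_diff.
rewrite -big_split; apply: eq_bigr => k _ /=; rewrite !mpartialE.
by rewrite partialM//; exact: smooth_mx_diff.
Qed.

Lemma mpartial_commute p q c d (F : 'rV[R]_n -> 'M[R]_(p, q)) x :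
  smooth_mx F -> V x ->
  mpartial c (mpartial d F) x = mpartial d (mpartial c F) x.
Proof.
move=> sF Vx; apply/matrixP => i j; rewrite !mpartialE.
have E e : (fun y => mpartial e F y i j) = partial e (fun y => F y i j).
  by apply/funext => y; rewrite mpartialE.
by rewrite !E (partial_commute c d oV (sF i j) Vx).
Qed.

End MatrixCalculus.

Lemma trmxD (R : zmodType) p q (A B : 'M[R]_(p, q)) : (A + B)^T = A^T + B^T.
Proof. exact: raddfD. Qed.

Lemma trmxN (R : zmodType) p q (A : 'M[R]_(p, q)) : (- A)^T = - A^T.
Proof. exact: raddfN. Qed.

(* [ring] and [lra] compare atoms up to conversion, which is very slow on
   unfoldable tensor components: make these atoms opaque first. *)
Ltac abstract_atoms :=
  repeat (match goal with
  | |- context [@christoffel ?R ?n ?g ?x ?a ?b ?c] =>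
    move: (@christoffel R n g x a b c)
  | |- context [@cky_covector ?R ?n ?g ?Y ?x ?a] =>
    move: (@cky_covector R n g Y x a)
  | |- context [@nabla2 ?R ?n ?g ?T ?x ?c ?a ?b] =>
    move: (@nabla2 R n g T x c a b)
  | |- context [@partial ?R ?n ?a ?f ?x] => move: (@partial R n a f x)
  | |- context [@fun_of_matrix ?R ?m ?n ?M ?i ?j] =>
    move: (@fun_of_matrix R m n M i j)
  end => ?).

Ltac tring := abstract_atoms; rewrite /=; ring.
Ltac tlra := abstract_atoms; rewrite /=; lra.

(** Identities in noncommuting matrices: expand all products, take each of them as an atom, and
    compare entries linearly. *)
Ltac mxabel :=
  repeat (match goal with |- context [@mpartial.body ?R ?n ?p ?q ?c ?F ?x] =>
    move: (@mpartial.body R n p q c F x) end => ?);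
  rewrite ?(mulmxDl, mulmxDr, mulmxBl, mulmxBr, mulNmx, mulmxN, mulmxA);
  repeat (match goal with |- context [@mulmx ?R ?m ?n ?p ?A ?B] =>
    move: (@mulmx R m n p A B) end => ?);
  apply/matrixP => ? ?; rewrite !mxE; tring.

Lemma cyclic_mulmx (R : comNzRingType) n (O : 'I_n -> 'I_n -> 'M[R]_n)
    (A : 'M[R]_n) i j k l :
  (forall i j k l, O i j k l + O j k i l + O k i j l = 0) ->
  (O i j *m A) k l + (O j k *m A) i l + (O k i *m A) j l = 0.
Proof.
move=> B; rewrite !mxE -!big_split big1// => e _ /=.
by rewrite -!mulrDl B mul0r.
Qed.

(** The classical exchange of index pairs composed with both antisymmetries, hence a full reversal
    of the indices. It follows linearly from four cyclic identities, one for each index kept in last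
    place, and from antisymmetries. *)
Lemma riemann_pair_sym (R : realDomainType) (I : Type)
    (T : I -> I -> I -> I -> R) :
  (forall i j k l, T i j k l = - T j i k l) ->
  (forall i j k l, T i j k l = - T i j l k) ->
  (forall i j k l, T i j k l + T j k i l + T k i j l = 0) ->
  forall a b c d, T a b c d = T d c b a.
Proof.
move=> A1 A2 B a b c d.
have := B a b c d; have := B b c d a; have := B c d a b; have := B d a b c.
have := A1 c a b d; have := A2 a c b d; have := A1 d b c a.
have := A2 b c d a; have := A1 b c d a; have := A2 b d c a.
have := A2 c d a b; have := A1 c d a b; have := A1 d a b c.
have := A2 a b c d; have := A1 a b c d; have := A2 d a b c.
have := A2 b d a c; have := A2 c d b a; have := A2 d c a b.
have := A2 c b a d; have := A1 c b a d.
lra.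
Qed.

(** * Metric compatibility, the Ricci identity and the symmetries of the curvature *)

Section Connection.
Context {R : realType} {n : nat}.
Variables (V : set 'rV[R]_n) (g : 'rV[R]_n -> 'M[R]_n).
Hypotheses (oV : open V) (sg : smooth_mx V g).
Hypotheses (gT : forall y, V y -> (g y)^T = g y).
Hypotheses (gu : forall y, V y -> g y \in unitmx).
Implicit Types (x y : 'rV[R]_n) (a b c d e : 'I_n).

Local Notation G y := (invmx (g y)).
Local Notation Gam := (Gam g).
Local Notation Om := (Om g).

Definition nab c (T : 'rV[R]_n -> 'M[R]_n) x : 'M[R]_n :=
  mpartial c T x - Gam c x *m T x - T x *m (Gam c x)^T.

Lemma nab_def c T x :
  nab c T x = mpartial c T x - Gam c x *m T x - T x *m (Gam c x)^T.
Proof. by []. Qed.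

Lemma nabE c T x a b : nab c T x a b = nabla2 g T x c a b.
Proof.
rewrite /nab /nabla2 !mxE mpartialE -addrA -opprD -big_split; congr (_ - _).
by apply: eq_bigr => d _; rewrite [_^T _ _]mxE !GamE; tring.
Qed.

Lemma metric_sym y a b : V y -> g y a b = g y b a.
Proof. by move=> Vy; rewrite -{1}(gT Vy) mxE. Qed.

Lemma smooth_inverse_metric : smooth_mx V (fun y => G y).
Proof. by move=> i j; exact: smooth_on_invmx. Qed.

Lemma inverse_metric_tr y : V y -> (G y)^T = G y.
Proof. by move=> Vy; rewrite trmx_inv gT. Qed.

Lemma inverse_metric_sym y a b : V y -> G y a b = G y b a.
Proof. by move=> Vy; rewrite -{1}(inverse_metric_tr Vy) mxE. Qed.

Lemma smooth_christoffel a b d : smooth_on V (fun y => christoffel g y d a b).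
Proof.
apply: smooth_onM => //; first exact: smooth_on_cst.
apply: smooth_on_sum => // e; apply: smooth_onM => //.
  exact: smooth_inverse_metric.
apply: smooth_onB => //; first apply: smooth_onD => //.
all: exact/smooth_on_partial/sg.
Qed.

Lemma smooth_Gam c : smooth_mx V (Gam c).
Proof.
by move=> a d; under eq_fun do rewrite GamE; exact: smooth_christoffel.
Qed.

Lemma christoffel_sym x a b d : V x ->
  christoffel g x d a b = christoffel g x d b a.
Proof.
move=> Vx; rewrite /christoffel; congr (_ * _); apply: eq_bigr => e _.
have -> : partial e (fun y => g y a b) x = partial e (fun y => g y b a) x.
  by apply: (partial_ext _ oV Vx) => y Vy; exact: metric_sym.
tring.
Qed.

(** Lowering the upper index cancels the inverse metric and leaves the Christoffel symbols of the
    first kind, after which [nabla_metric] is linear arithmetic. *)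
Lemma christoffel_low x c a f : V x ->
  (Gam c x *m g x) a f = 2^-1 * (partial c (fun y => g y f a) x
    + partial a (fun y => g y f c) x - partial f (fun y => g y c a) x).
Proof.
move=> Vx; rewrite mxE.
under eq_bigr do rewrite GamE /christoffel -mulrA mulr_suml.
rewrite -mulr_sumr exchange_big /=; congr (_ * _).
under eq_bigr => e _.
  under eq_bigr => d _ do rewrite mulrAC (inverse_metric_sym _ _ Vx).
  rewrite -mulr_suml.
  have -> : \sum_i invmx (g x) e i * g x i f = (e == f)%:R.
    by have := mulVmx (gu Vx) => /matrixP /(_ e f); rewrite !mxE.
  over.
rewrite (bigD1 f)//= eqxx mul1r big1 ?addr0// => e /negbTE ->.
by rewrite mul0r.
Qed.

Lemma nabla_metric c x : V x -> nab c g x = 0.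
Proof.
move=> Vx; rewrite /nab; apply/matrixP => a b.
have E : g x *m (Gam c x)^T = (Gam c x *m g x)^T by rewrite trmx_mul gT.
have P (i j k : 'I_n) :
    partial i (fun y => g y j k) x = partial i (fun y => g y k j) x.
  by apply: (partial_ext _ oV Vx) => y Vy; exact: metric_sym.
rewrite E; move: (christoffel_low c a b Vx) (christoffel_low c b a Vx).
move: (Gam c x *m g x) => M Mab Mba; rewrite !mxE mpartialE Mab Mba.
rewrite (P c b a) (P a b c) (P b a c); tlra.
Qed.

Lemma mpartial_metric c x : V x ->
  mpartial c g x = Gam c x *m g x + g x *m (Gam c x)^T.
Proof.
move=> Vx; have /eqP := nabla_metric c Vx.
by rewrite /nab -addrA -opprD subr_eq0 => /eqP.
Qed.

Lemma partial_metric c x a b : V x ->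
  partial c (fun y => g y a b) x =
  \sum_d (christoffel g x d c a * g x d b + christoffel g x d c b * g x a d).
Proof.
move=> Vx; have /matrixP /(_ a b) := nabla_metric c Vx.
by rewrite nabE mxE /nabla2 => /eqP; rewrite subr_eq0 => /eqP.
Qed.

(** Obtained by differentiating [G y *m g y = 1%:M] and substituting nabla g = 0. *)
Lemma mpartial_inverse_metric c x : V x ->
  mpartial c (fun y => G y) x = - (G x *m Gam c x + (Gam c x)^T *m G x).
Proof.
move=> Vx.
have E : mpartial c (fun y => G y *m g y) x = 0.
  rewrite -(mpartial_cst c (1%:M : 'M[R]_n) x); apply: (mpartial_ext oV) => //.
  by move=> y Vy; rewrite mulVmx// gu.
rewrite (mpartialM (V := V)) // in E; last exact: smooth_inverse_metric.
rewrite mpartial_metric// in E.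
rewrite -[LHS](mulmxK (gu Vx)).
move/eqP: E; rewrite addr_eq0 => /eqP ->.
rewrite mulNmx mulmxDr mulmxDl !mulmxA (mulmxK (gu Vx)).
by rewrite (mulVmx (gu Vx)) mul1mx.
Qed.

(** The curvature of the connection matrices; the products appear in reversed order because rows of
    [Gam] carry the lower index. *)
Lemma OmE c d x : V x ->
  Om c d x = mpartial c (Gam d) x - mpartial d (Gam c) x
             + Gam d x *m Gam c x - Gam c x *m Gam d x.
Proof.
move=> Vx; apply/matrixP => b a.
have E f : (fun y => Gam f y b a) = fun y => christoffel g y a f b.
  by apply/funext => y; rewrite GamE.
rewrite Om_riemann !mxE !mpartialE !E /riemann -[RHS]addrA; congr (_ + _); rewrite -sumrB.
by apply: eq_bigr => e _; rewrite !GamE; tring.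
Qed.

Lemma ricciE x b d : ricci g x b d = \sum_a Om a d x b a.
Proof. by rewrite mxE; apply: eq_bigr => a _; rewrite Om_riemann. Qed.

Lemma Om_antisym c d x : V x -> Om d c x = - Om c d x.
Proof.
move=> Vx; rewrite !OmE//; move: (Gam c x) (Gam d x) => ? ?; mxabel.
Qed.

Lemma smooth_nab c T : smooth_mx V T -> smooth_mx V (nab c T).
Proof.
move=> sT; apply: smooth_mxD => //; first apply: smooth_mxD => //.
- exact: smooth_mx_mpartial.
- by apply: smooth_mxN => //; apply: smooth_mxM => //; exact: smooth_Gam.
apply: smooth_mxN => //; apply: smooth_mxM => //.
by apply: smooth_mxT; exact: smooth_Gam.
Qed.

(** The Ricci identity. In [nab c (nab d T)] the index [d] is a mere label without Christoffel
    correction: that correction is symmetric in [c] and [d] and would cancel in the commutator. *)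
Lemma nab_commute c d T x : smooth_mx V T -> V x ->
  nab c (nab d T) x - nab d (nab c T) x
  = - (Om c d x *m T x + T x *m (Om c d x)^T).
Proof.
move=> sT Vx.
have sGT (e : 'I_n) : smooth_mx V (fun y => (Gam e y)^T).
  by apply: smooth_mxT; exact: smooth_Gam.
have s1 (e : 'I_n) : smooth_mx V (fun y => Gam e y *m T y).
  by apply: smooth_mxM => //; exact: smooth_Gam.
have s2 (e : 'I_n) : smooth_mx V (fun y => T y *m (Gam e y)^T).
  exact: smooth_mxM.
have E e f : mpartial e (nab f T) x = mpartial e (mpartial f T) x
   - (mpartial e (Gam f) x *m T x + Gam f x *m mpartial e T x)
   - (mpartial e T x *m (Gam f x)^T + T x *m (mpartial e (Gam f) x)^T).
  rewrite /nab (mpartialD (V := V)) //; last exact: smooth_mxN.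
    rewrite (mpartialD (V := V)) //; last exact: smooth_mxN.
      rewrite !(mpartialN (V := V)) // !(mpartialM (V := V)) //; last exact: smooth_Gam.
      by rewrite mpartialT.
    exact: smooth_mx_mpartial.
  apply: smooth_mxD => //; last exact: smooth_mxN.
  exact: smooth_mx_mpartial.
rewrite {1 3}/nab !E (mpartial_commute oV c d sT Vx) OmE// /nab.
rewrite !(trmxD, trmxN, trmx_mul).
move: (Gam c x) (Gam d x) (T x) => ? ? ?; mxabel.
Qed.

(** The Ricci identity for the parallel tensor [g]: lowered curvature is skew in its last two
    indices. *)
Lemma Om_metric c d x : V x ->
  Om c d x *m g x + g x *m (Om c d x)^T = 0.
Proof.
move=> Vx; have := nab_commute c d sg Vx.
have E e f : nab e (nab f g) x = 0.
  rewrite /nab -/(nab f g x) nabla_metric//.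
  rewrite (mpartial_ext oV e Vx (H := fun=> 0)); last first.
    by move=> y Vy; exact: nabla_metric.
  by rewrite mpartial_cst !mulmx0 mul0mx !subr0.
by rewrite !E subrr => /eqP; rewrite eq_sym oppr_eq0 => /eqP.
Qed.

Lemma Om_bianchi b c d x a : V x -> Om c d x b a + Om d b x c a + Om b c x d a = 0.
Proof.
move=> Vx; rewrite !Om_riemann /riemann.
have P (i j k : 'I_n) : partial i (fun y => christoffel g y a j k) x
    = partial i (fun y => christoffel g y a k j) x.
  by apply: (partial_ext _ oV Vx) => y Vy; exact: christoffel_sym.
have Q : \sum_e (christoffel g x a c e * christoffel g x e d b
                 - christoffel g x a d e * christoffel g x e c b)
       + \sum_e (christoffel g x a d e * christoffel g x e b c
                 - christoffel g x a b e * christoffel g x e d c)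
       + \sum_e (christoffel g x a b e * christoffel g x e c d
                 - christoffel g x a c e * christoffel g x e b d) = 0.
  rewrite -!big_split big1// => e _.
  rewrite (christoffel_sym d b e Vx) (christoffel_sym c b e Vx).
  rewrite (christoffel_sym d c e Vx); tring.
have cyc (p q r s1 s2 s3 : R) : s1 + s2 + s3 = 0 ->
  p - q + s1 + (q - r + s2) + (r - p + s3) = 0 by move=> <-; ring.
by rewrite (P c d b) (P d c b) (P b d c); exact: cyc.
Qed.

(* [Riem c d a b] is R_bacd with all indices lowered. *)
Definition Riem c d x : 'M[R]_n := Om c d x *m g x.

Lemma Riem_pair_sym c d a b x : V x -> Riem c d x a b = Riem b a x d c.
Proof.
move=> Vx; apply: (@riemann_pair_sym R 'I_n (fun i j => Riem i j x)).
- by move=> i j k l; rewrite /Riem (Om_antisym j i Vx) mulNmx mxE.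
- move=> i j k l; have /matrixP /(_ k l) := Om_metric i j Vx.
  rewrite /Riem -[X in X *m (Om _ _ _)^T]gT// -trmx_mul.
  move: (Om i j x *m g x) => M; rewrite !mxE => /eqP.
  by rewrite addr_eq0 => /eqP.
move=> i j k l; apply: (@cyclic_mulmx R n (fun i j => Om i j x)) => p q r e.
exact: (Om_bianchi r p q e Vx).
Qed.

End Connection.

(** * The Killing property of xi *)

Section KillingAlgebra.
Context {R : realType} {n : nat}.
Implicit Types (A B g G Y : 'M[R]_n).

(* The derivative along a fixed direction of the symmetrized CKY equation: [dN],
   [dg], [dxi] are the partial derivatives of [N], [g], [xi], and [C e a] stands
   for the Christoffel symbols with that direction as one lower index. *)
Lemma cky_equation_derivative (N dN : 'I_n -> 'I_n -> 'I_n -> R)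
    (g dg C : 'I_n -> 'I_n -> R) (xi dxi : 'I_n -> R) :
  (forall c a b, N c a b + N a c b
     = 2 * (g c a * xi b) - g c b * xi a - g a b * xi c) ->
  (forall c a b, dN c a b + dN a c b
     = 2 * (dg c a * xi b + g c a * dxi b)
       - (dg c b * xi a + g c b * dxi a) - (dg a b * xi c + g a b * dxi c)) ->
  (forall a b, dg a b = \sum_e (C e a * g e b + C e b * g a e)) ->
  let D c a b := dN c a b
    - \sum_e (C e a * N c e b + C e b * N c a e + C e c * N e a b) in
  let A a := dxi a - \sum_e C e a * xi e in
  forall c a b, D c a b + D a c b
     = 2 * (g c a * A b) - g c b * A a - g a b * A c.
Proof.
move=> E dE dgE D A c a b; rewrite /D /A.
(* The Christoffel corrections of both copies of [N] add up to those of the right-hand side: the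
   hypothesis on [N] is used with one slot replaced by the summation index, and metric compatibility
   rewrites [dg]. *)
have S : \sum_e (C e a * N c e b + C e b * N c a e + C e c * N e a b)
       + \sum_e (C e c * N a e b + C e b * N a c e + C e a * N e c b)
  = 2 * (dg c a * xi b + g c a * \sum_e C e b * xi e)
    - (dg c b * xi a + g c b * \sum_e C e a * xi e)
    - (dg a b * xi c + g a b * \sum_e C e c * xi e).
  rewrite !dgE !mulr_suml !mulr_sumr -!big_split mulr_sumr -!sumrB.
  apply: eq_bigr => e _ /=.
  have E1 : N e c b = 2 * (g c e * xi b) - g c b * xi e - g e b * xi c - N c e b.
    by rewrite -E; ring.
  have E2 : N a c e = 2 * (g c a * xi e) - g c e * xi a - g a e * xi c - N c a e.
    by rewrite -E; ring.
  have E3 : N a e b = 2 * (g e a * xi b) - g e b * xi a - g a b * xi e - N e a b.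
    by rewrite -E; ring.
  rewrite E1 E2 E3; ring.
rewrite addrACA dE -opprD S; ring.
Qed.

(** Taking the trace against [G] gives 4(n - 1) tr(A G) = 0. The trace term then drops out and (n -
    2)(A + A^T) = 0 remains. *)
Lemma killing_of_contracted (G g A : 'M[R]_n) : (3 <= n)%N ->
  g *m G = 1%:M -> G^T = G ->
  (n%:R - 1) *: (A + A^T) = A + A^T - (2 * \tr (A *m G)) *: g ->
  A + A^T = 0.
Proof.
move=> n3 gG GT E.
have n3' : (3 : R) <= n%:R by rewrite ler_nat.
have trS : \tr ((A + A^T) *m G) = 2 * \tr (A *m G).
  rewrite mulmxDl mxtraceD -{2}GT -trmx_mul mxtrace_tr [\tr (G *m A)]mxtrace_mulC.
  ring.
have := congr1 (fun M => \tr (M *m G)) E.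
rewrite -scalemxAl mxtraceZ mulmxBl linearB /= -scalemxAl mxtraceZ trS gG mxtrace1.
set t := \tr (A *m G) => Et.
have t0 : t = 0.
  have : (n%:R - 1) * t = 0 by move: Et; lra.
  by move/eqP; rewrite mulf_eq0 => /orP[/eqP|/eqP //]; lra.
have : (n%:R - 2 : R) *: (A + A^T) = 0.
  have -> : n%:R - 2 = (n%:R - 1) - 1 :> R by ring.
  by rewrite scalerBl E -/t t0 mulr0 scale0r subr0 scale1r subrr.
move/eqP; rewrite scaler_eq0 => /orP[/eqP n2|/eqP //].
by exfalso; move: n2 n3'; clear; lra.
Qed.

(** Here [D d c] stands for nabla_d nabla_c Y, [A] for nabla xi and [X] for the contracted curvature
    term. The contraction of [D], symmetrized in [c] and [a], is computed twice: from the CKY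
    equation, and by commuting derivatives, where [X] cancels. *)
Lemma contracted_cky_derivative (G g A : 'M[R]_n) (D : 'I_n -> 'I_n -> 'M[R]_n)
    (X : 'M[R]_n) : (3 <= n)%N ->
  g *m G = 1%:M -> G^T = G -> X^T = - X ->
  (forall d c a b, D d c a b + D d a c b
     = 2 * (g c a * A d b) - g c b * A d a - g a b * A d c) ->
  (forall c a, \sum_d (D d c *m G) a d = - (n%:R - 1) * A c a + X c a) ->
  A + A^T = 0.
Proof.
move=> n3 gG GT XT E1 E2; apply: (@killing_of_contracted G g) => //.
apply/matrixP => c a; rewrite !mxE.
have Xs : X c a + X a c = 0.
  by move/matrixP : XT => /(_ c a); rewrite !mxE => ->; rewrite subrr.
have sumE c' a' : \sum_d \sum_b g c' b * A d a' * G b d = A c' a'.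
  rewrite (eq_bigr (fun d => (c' == d)%:R * A d a')) => [|d _].
    rewrite (bigD1 c')//= eqxx mul1r big1 ?addr0// => d.
    by rewrite eq_sym => /negbTE ->; rewrite mul0r.
  have <- : (g *m G) c' d = (c' == d)%:R by rewrite gG mxE.
  by rewrite mxE mulr_suml; apply: eq_bigr => b _; rewrite mulrAC.
have := E2 c a; have := E2 a c.
have : \sum_d (D d c *m G) a d + \sum_d (D d a *m G) c d
   = 2 * (g c a * \tr (A *m G)) - A c a - A a c.
  rewrite -(sumE c a) -(sumE a c) -big_split /= /mxtrace !mulr_sumr -!sumrB.
  apply: eq_bigr => d _; rewrite !mxE -big_split /= !mulr_sumr -!sumrB.
  by apply: eq_bigr => b _; rewrite -mulrDl E1; ring.
set s1 := \sum_d _; set s2 := \sum_d _ => e3 e1 e2; lra.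
Qed.

(** The commutator has two halves: one contracts the curvature with itself to Ricci and yields a
    multiple of [Y], the other, [P], contracts lowered curvature with the skew bivector
    [G *m Y *m G]. *)
Lemma contracted_curvature_antisym (O : 'I_n -> 'I_n -> 'M[R]_n) (G g Y : 'M[R]_n)
    (L : R) :
  g *m G = 1%:M -> G *m g = 1%:M -> G^T = G -> Y^T = - Y ->
  (forall c d, O c d *m g + g *m (O c d)^T = 0) ->
  (forall c d a b, (O c d *m g) a b = (O b a *m g) d c) ->
  (forall e c, \sum_d O d c e d = L * g e c) ->
  forall c a, \sum_d ((O d c *m Y + Y *m (O d c)^T) *m G) a d
            = - \sum_d ((O d a *m Y + Y *m (O d a)^T) *m G) c d.
Proof.
move=> gG Gg GT YT Og Op Ric c a.
pose P c a := \sum_d (O d c *m Y *m G) a d.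
have Y0 i j : Y i j = - Y j i.
  by have /matrixP /(_ j i) := YT; rewrite !mxE.
have splitP c' a' : \sum_d ((O d c' *m Y + Y *m (O d c')^T) *m G) a' d
    = P c' a' - L * Y a' c'.
  rewrite /P; have -> : L * Y a' c' = \sum_d (Y *m G *m O d c') a' d.
    under eq_bigr do rewrite mxE.
    rewrite exchange_big /=.
    under eq_bigr do rewrite -mulr_sumr Ric mulrCA.
    rewrite -mulr_sumr; congr (_ * _).
    by rewrite -[in LHS](mulmx1 Y) -Gg mulmxA mxE.
  rewrite -sumrB; apply: eq_bigr => d _; rewrite mulmxDl mxE; congr (_ + _).
  have -> : Y *m (O d c')^T *m G = - (Y *m G *m O d c').
    have /eqP := Og d c'; rewrite addrC addr_eq0 => /eqP OgE.
    have -> : (O d c')^T = - (G *m (O d c' *m g)).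
      by rewrite -mulmxN -OgE mulmxA Gg mul1mx.
    by rewrite mulmxN mulNmx !mulmxA -[_ *m g *m G]mulmxA gG mulmx1.
  by rewrite mxE.
have PE c' a' : P c' a' = \sum_d \sum_f (O d c' *m g) a' f * (G *m Y *m G) f d.
  apply: eq_bigr => d _; have <- : O d c' *m g *m (G *m Y *m G) = O d c' *m Y *m G.
    by rewrite !mulmxA -(mulmxA (O d c') g G) gG mulmx1.
  by rewrite mxE.
have BT : (G *m Y *m G)^T = - (G *m Y *m G).
  by rewrite !trmx_mul GT YT mulNmx mulmxN mulmxA.
(* Reversing the four curvature indices exchanges [a] with [c] and the two summation indices with
   each other, so the skewness of the bivector gives the sign. *)
have PT : P c a = - P a c.
  rewrite !PE exchange_big -sumrN; apply: eq_bigr => d _ /=.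
  rewrite -sumrN; apply: eq_bigr => f _; rewrite Op -mulrN; congr (_ * _).
  by have /matrixP /(_ f d) := BT; rewrite [LHS]mxE [RHS]mxE => ->.
by rewrite !splitP PT (Y0 a c); ring.
Qed.

End KillingAlgebra.

Lemma partial_cky_rhs (R : realType) n (f1 f2 f3 h1 h2 h3 : 'rV[R]_n -> R) d x :
  differentiable f1 x -> differentiable f2 x -> differentiable f3 x ->
  differentiable h1 x -> differentiable h2 x -> differentiable h3 x ->
  partial d (fun y => 2 * (f1 y * h1 y) - f2 y * h2 y - f3 y * h3 y) x
  = 2 * (partial d f1 x * h1 x + f1 x * partial d h1 x)
    - (partial d f2 x * h2 x + f2 x * partial d h2 x)
    - (partial d f3 x * h3 x + f3 x * partial d h3 x).
Proof.
move=> F1 F2 F3 H1 H2 H3.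
have M1 := differentiableM F1 H1; have M2 := differentiableM F2 H2.
have M3 := differentiableM F3 H3.
have d2 : differentiable (fun=> 2 : R) x by exact: differentiable_cst.
have M21 := differentiableM d2 M1.
have N2 := differentiableN M2; have N3 := differentiableN M3.
rewrite (partialD d (differentiableD M21 N2) N3) (partialD d M21 N2).
rewrite (partialN d M2) (partialN d M3) (partialM d d2 M1) partial_cst mul0r add0r.
by rewrite (partialM d F1 H1) (partialM d F2 H2) (partialM d F3 H3).
Qed.

(** * Application to a CKY 2-form in an Einstein chart *)

Section CKYKilling.
Context {R : realType} {n : nat}.
Variables (V : set 'rV[R]_n) (g Y : 'rV[R]_n -> 'M[R]_n).
Hypotheses (oV : open V) (sg : smooth_mx V g) (sY : smooth_mx V Y).
Hypotheses (gT : forall y, V y -> (g y)^T = g y).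
Hypotheses (gu : forall y, V y -> g y \in unitmx).
Hypotheses (YT : forall y, V y -> (Y y)^T = - Y y).
Hypothesis n_ge3 : (3 <= n)%N.
Variable L : R.
Hypothesis ricg : forall y, V y -> ricci g y = L *: g y.
Hypothesis cky : forall y, V y ->
  exists2 z : 'I_n -> 'I_n -> 'I_n -> R, totally_antisymmetric z &
    forall a b c : 'I_n, nabla2 g Y y c a b =
      g y c a * cky_covector g Y y b - g y c b * cky_covector g Y y a + z a b c.
Implicit Types (x y : 'rV[R]_n) (a b c d e : 'I_n).

Local Notation xi y a := (cky_covector g Y y a).
Local Notation N c := (nab g c Y).

(* nabla_c w_a *)
Definition nabla1 (w : 'rV[R]_n -> 'I_n -> R) x c a : R :=
  partial c (fun y => w y a) x - \sum_e christoffel g x e c a * w x e.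

Lemma smooth_cky_covector a : smooth_on V (fun y => xi y a).
Proof.
apply: smooth_onM => //; first exact: smooth_on_cst.
apply: smooth_on_sum => // b; apply: smooth_on_sum => // c.
apply: smooth_onM => //; first exact: (smooth_inverse_metric oV).
under eq_fun do rewrite -nabE; exact: (smooth_nab oV sg gu).
Qed.

(** Exchanging the outer indices of [z] is odd, so symmetrizing in [c] and [a] removes it. This
    allows differentiation, as [z] is only chosen point by point. *)
Lemma cky_symmetrized y c a b : V y ->
  N c y a b + N a y c b
  = 2 * (g y c a * xi y b) - g y c b * xi y a - g y a b * xi y c.
Proof.
move=> Vy; have [z zA E] := cky Vy.
have [z1 _] := zA b c a; have [_ z2] := zA b a c; have [z3 _] := zA a b c.
have zz : z c b a = - z a b c by rewrite z1 z2 z3 opprK.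
have := E a b c; have := E c b a.
by rewrite -nabE -nabE (metric_sym gT a c Vy) zz => -> ->; tring.
Qed.

Lemma nab_antisym c y a b : V y -> N c y b a = - N c y a b.
Proof.
move=> Vy; have E : (N c y)^T = - N c y.
  rewrite nab_def !(trmxD, trmxN, trmx_mul) trmxK YT// -mpartialT.
  have -> : mpartial c (fun y => (Y y)^T) y = - mpartial c Y y.
    rewrite -(mpartialN (V := V))//.
    by apply: (mpartial_ext oV) => // w Vw; rewrite YT.
  by move: (Gam g c y) (Y y) => A B; mxabel.
by have /matrixP /(_ a b) := E; rewrite [LHS]mxE [RHS]mxE.
Qed.

(** The definition of [xi] contracts the first slot of [Y], this sum the second: hence the minus
    sign. *)
Lemma cky_divergence y a : V y ->
  \sum_d (N d y *m invmx (g y)) a d = - (n%:R - 1) * xi y a.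
Proof.
move=> Vy; have n1 : (n%:R - 1 : R) != 0.
  by rewrite subr_eq0 pnatr_eq1; apply: contraTneq n_ge3 => ->.
rewrite /cky_covector mulrA mulNr divff// mulN1r exchange_big /= -sumrN.
apply: eq_bigr => d _; rewrite mxE -sumrN; apply: eq_bigr => b _.
by rewrite -nabE (nab_antisym _ _ _ Vy); ring.
Qed.

(* nabla_d nabla_c Y *)
Definition nab_nab d c y : 'M[R]_n :=
  nab g d (N c) y - \sum_e christoffel g y e d c *: N e y.

Lemma smooth_N c : smooth_mx V (N c).
Proof. exact: (smooth_nab oV sg gu). Qed.

Lemma nab_nabE d c y a b : nab_nab d c y a b =
  partial d (fun y => N c y a b) y
  - \sum_e (christoffel g y e d a * N c y e b + christoffel g y e d b * N c y a e
            + christoffel g y e d c * N e y a b).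
Proof.
rewrite /nab_nab mxE nabE /nabla2 [X in _ + X]mxE summxE -addrA -opprD -big_split.
by congr (_ - _); apply: eq_bigr => e _; rewrite /= [X in _ + X = _]mxE.
Qed.

Lemma nab_nab_symmetrized y d c a b : V y ->
  nab_nab d c y a b + nab_nab d a y c b
  = 2 * (g y c a * nabla1 (cky_covector g Y) y d b)
    - g y c b * nabla1 (cky_covector g Y) y d a
    - g y a b * nabla1 (cky_covector g Y) y d c.
Proof.
move=> Vy.
apply: etrans (congr2 +%R (nab_nabE d c y a b) (nab_nabE d a y c b)) _.
have sxi e := smooth_on_diff (smooth_cky_covector e) Vy.
have sgd i j := smooth_mx_diff i j sg Vy.
have sN e i j := smooth_mx_diff i j (smooth_N e) Vy.
apply: (@cky_equation_derivative R n (fun c => N c y)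
  (fun c a b => partial d (fun y => N c y a b) y)
  (g y) (fun a b => partial d (fun y => g y a b) y)
  (fun e a => christoffel g y e d a) (fun a => xi y a)
  (fun a => partial d (fun y => xi y a) y)).
- by move=> i j k; exact: cky_symmetrized.
- move=> i j k.
  rewrite -(partial_cky_rhs d (sgd _ _) (sgd _ _) (sgd _ _) (sxi _) (sxi _) (sxi _)).
  rewrite -(partialD _ (sN _ _ _) (sN _ _ _)).
  by apply: (partial_ext _ oV Vy) => w Vw; exact: cky_symmetrized.
- by move=> i j; rewrite (partial_metric oV gT gu).
Qed.

(** Contraction commutes with nabla_c because the inverse metric is parallel. The Christoffel terms
    of the contracted pair cancel ([S2]), and the one left for [a] ([S3]) completes the covariant
    derivative of [xi]. *)
Lemma contracted_nab_nab y c a : V y ->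
  \sum_d (nab_nab c d y *m invmx (g y)) a d
  = - (n%:R - 1) * nabla1 (cky_covector g Y) y c a.
Proof.
move=> Vy; pose G y := invmx (g y).
have sG : smooth_mx V G by exact: (smooth_inverse_metric oV).
have GsT : (G y)^T = G y by exact: (inverse_metric_tr gT).
have sNG d : smooth_mx V (fun y => N d y *m G y).
  by apply: smooth_mxM => //; exact: smooth_N.
have dNG d i j := smooth_mx_diff i j (sNG d) Vy.
have E d : nab g c (N d) y *m G y = mpartial c (fun y => N d y *m G y) y
    + N d y *m G y *m Gam g c y - Gam g c y *m (N d y *m G y).
  rewrite (mpartialM c (smooth_N d) sG Vy).
  rewrite (mpartial_inverse_metric oV sg gT gu c Vy) -/(G y) {1}nab_def.
  move: (N d y) (G y) (Gam g c y) => A B C; mxabel.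
have S2 : \sum_d (\sum_e christoffel g y e c d *: N e y *m G y) a d
    = \sum_d (N d y *m G y *m Gam g c y) a d.
  under eq_bigr do rewrite summxE.
  rewrite exchange_big; apply: eq_bigr => e _ /=.
  rewrite [RHS]mxE; apply: eq_bigr => d _.
  by rewrite -scalemxAl [LHS]mxE mulrC GamE.
have S1 : \sum_d (mpartial c (fun y => N d y *m G y) y) a d
   = - (n%:R - 1) * partial c (fun y => xi y a) y.
  under eq_bigr do rewrite mpartialE.
  rewrite -(partial_sum _ _ _ (fun d => dNG d a d)).
  have dxi := smooth_on_diff (smooth_cky_covector a) Vy.
  have dc : differentiable (fun=> - (n%:R - 1) : R) y by exact: differentiable_cst.
  transitivity (partial c (fun y => - (n%:R - 1) * xi y a) y).
    by apply: (partial_ext _ oV Vy) => w Vw; exact: cky_divergence.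
  by rewrite (partialM _ dc dxi) partial_cst mul0r add0r.
have S3 : \sum_d (Gam g c y *m (N d y *m G y)) a d
   = - (n%:R - 1) * \sum_e christoffel g y e c a * xi y e.
  under eq_bigr do rewrite mxE.
  rewrite exchange_big /= mulr_sumr; apply: eq_bigr => e _.
  by rewrite -mulr_sumr cky_divergence// GamE mulrCA.
rewrite /nabla1 mulrBr -S1 -S3.
have -> : \sum_d (nab_nab c d y *m G y) a d = \sum_d (nab g c (N d) y *m G y) a d
    - \sum_d (\sum_e christoffel g y e c d *: N e y *m G y) a d.
  rewrite -sumrB; apply: eq_bigr => d _.
  by rewrite /nab_nab mulmxBl mulmx_suml [LHS]mxE [X in _ + X = _]mxE.
rewrite S2; under eq_bigr do rewrite E.
rewrite -!sumrB; apply: eq_bigr => d _.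
move: (mpartial _ _ _) (_ *m _ *m Gam _ _ _) (Gam _ _ _ *m _) => A B C.
by rewrite !mxE; tring.
Qed.

Theorem cky_covector_killing x a b : V x ->
  nabla1 (cky_covector g Y) x a b + nabla1 (cky_covector g Y) x b a = 0.
Proof.
move=> Vx; pose G := invmx (g x).
have gG : g x *m G = 1%:M by rewrite mulmxV// gu.
have Gg : G *m g x = 1%:M by rewrite mulVmx// gu.
have GsT : G^T = G by exact: (inverse_metric_tr gT).
pose O d c := Om g d c x.
(* The contracted commutator of nabla_d and nabla_c on [Y]; the Einstein equation is what makes it
   skew. *)
pose X := \matrix_(c, a)
  (- \sum_d ((O d c *m Y x + Y x *m (O d c)^T) *m G) a d).
have XT : X^T = - X.
  apply/matrixP => i j; rewrite !mxE opprK.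
  rewrite (@contracted_curvature_antisym R n O G (g x) (Y x) L) ?opprK// ?YT//.
  - by move=> c d; exact: (Om_metric oV sg gT gu).
  - by move=> c d p q; exact: (Riem_pair_sym oV sg gT gu).
  - by move=> e c; rewrite -ricciE ricg// mxE.
have [A AE] : exists A : 'M[R]_n, forall d c, A d c = nabla1 (cky_covector g Y) x d c.
  by exists (\matrix_(d, c) nabla1 (cky_covector g Y) x d c) => d c; rewrite mxE.
have : A + A^T = 0.
  apply: (@contracted_cky_derivative R n G (g x) A (fun d c => nab_nab d c x) X)
    => //.
    by move=> d c p q; rewrite !AE; exact: nab_nab_symmetrized.
  move=> c p; rewrite AE -contracted_nab_nab// [X c p]mxE -sumrB.
  apply: eq_bigr => d _.
  have -> : nab_nab d c x = nab_nab c d x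
       - (O d c *m Y x + Y x *m (O d c)^T).
    rewrite -(nab_commute oV sg gu d c sY Vx) /nab_nab.
    under eq_bigr do rewrite (christoffel_sym oV gT)//.
    move: (\sum_e _) (nab _ _ _ _) (nab _ _ _ _) => p1 p2 p3.
    by apply/matrixP => i j; rewrite !mxE; tring.
  by rewrite mulmxBl [LHS]mxE [X in _ + X = _]mxE.
by move/matrixP => /(_ a b); rewrite !mxE !AE.
Qed.

End CKYKilling.

(** * Conformal change of metric *)

Lemma sum_delta_l (R : pzSemiRingType) n (F : 'I_n -> R) d :
  \sum_a (a == d)%:R * F a = F d.
Proof.
rewrite (bigD1 d)//= eqxx mul1r big1 ?addr0// => a /negbTE ->.
by rewrite mul0r.
Qed.

Section ConformalAlgebra.
Context {R : realType} {n : nat}.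
Implicit Types (P Q : 'I_n -> 'I_n -> R) (u v w : 'I_n -> R) (k : R).

(** The left factor has the shape of a conformally changed Christoffel symbol [C' a d e] as a matrix
    in [a] and [e]; [contract_right] has the shape of [C' e a b]. Together they expand the product
    of two such symbols. *)
Lemma contract_left P Q u v w k d :
  \sum_a \sum_e (P a e + (a == d)%:R * u e + (a == e)%:R * k - v a * w e) * Q e a
  = \sum_a \sum_e P a e * Q e a + \sum_e u e * Q e d + k * \sum_a Q a a
    - \sum_a \sum_e v a * w e * Q e a.
Proof.
have -> : \sum_e u e * Q e d = \sum_a \sum_e (a == d)%:R * (u e * Q e a).
  rewrite -(sum_delta_l (fun a => \sum_e u e * Q e a)).
  by apply: eq_bigr => a _; rewrite mulr_sumr.
have -> : k * \sum_a Q a a = \sum_a \sum_e (a == e)%:R * (k * Q e a).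
  rewrite mulr_sumr; apply: eq_bigr => a _.
  rewrite -(sum_delta_l (fun e => k * Q e a)).
  by apply: eq_bigr => e _; rewrite eq_sym.
rewrite -!big_split -sumrB; apply: eq_bigr => a _ /=.
rewrite -!big_split -sumrB; apply: eq_bigr => e _ /=; ring.
Qed.

Lemma contract_right P Q u v w k b :
  \sum_a \sum_e P a e * (Q e a + (e == a)%:R * k + (e == b)%:R * u a - v e * w a)
  = \sum_a \sum_e P a e * Q e a + k * \sum_a P a a + \sum_a u a * P a b
    - \sum_a \sum_e v e * w a * P a e.
Proof.
rewrite exchange_big /=.
transitivity (\sum_a \sum_e (Q a e + (a == b)%:R * u e + (a == e)%:R * k
    - v a * w e) * P e a).
  by apply: eq_bigr => a _; apply: eq_bigr => e _; ring.
rewrite contract_left.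
have -> : \sum_a \sum_e Q a e * P e a = \sum_a \sum_e P a e * Q e a.
  by rewrite exchange_big; do 2 (apply: eq_bigr => ? _); rewrite mulrC.
have -> : \sum_a \sum_e v a * w e * P e a = \sum_a \sum_e v e * w a * P a e.
  by rewrite exchange_big.
by rewrite [X in X - _]addrAC.
Qed.

(* The change of the Ricci tensor under g -> e^(2u) g at a point, in terms of
   first derivatives of the Christoffel symbols: [C a d b] is Gamma^a_db,
   [dC c a d b] is its c-th partial derivative, [v] is the gradient of [u]. *)
Lemma conformal_ricci_algebra (C : 'I_n -> 'I_n -> 'I_n -> R)
    (dC : 'I_n -> 'I_n -> 'I_n -> 'I_n -> R) (g ddu dv : 'I_n -> 'I_n -> R)
    (dg : 'I_n -> 'I_n -> 'I_n -> R) (u v : 'I_n -> R) :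
  (forall a b d, C a d b = C a b d) ->
  (forall a b, g a b = g b a) ->
  (forall a b, ddu a b = ddu b a) ->
  (forall b, \sum_a g b a * v a = u b) ->
  (forall c b, \sum_a (dg c a b * v a + g a b * dv c a) = ddu c b) ->
  (forall c a b, dg c a b = \sum_e (C e c a * g e b + C e c b * g a e)) ->
  let C' a d b := C a d b + (a == d)%:R * u b + (a == b)%:R * u d
                  - v a * g d b in
  let dC' c a d b := dC c a d b + (a == d)%:R * ddu c b + (a == b)%:R * ddu c d
                  - (dv c a * g d b + v a * dg c d b) in
  let ric (C : 'I_n -> 'I_n -> 'I_n -> R) dC b d :=
    \sum_a (dC a a d b - dC d a a b
            + \sum_e (C a a e * C e d b - C a d e * C e a b)) in
  let N := \sum_a v a * u a in
  let div := \sum_a (dv a a + \sum_e C a a e * v e) in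
  forall b d, ric C' dC' b d = ric C dC b d
    - (n%:R - 2) * (ddu d b - \sum_e C e d b * u e - u d * u b)
    - (div + (n%:R - 2) * N) * g d b.
Proof.
move=> Cs gs dds gv dgv dgE C' dC' ric N div b d.
have n1 : \sum_(a < n) 1 = n%:R :> R by rewrite sumr_const card_ord.
pose t e := \sum_a C a a e.
have ricE (K : 'I_n -> 'I_n -> 'I_n -> R) dK : ric K dK b d =
    \sum_a dK a a d b - \sum_a dK d a a b
    + \sum_e (\sum_a K a a e) * K e d b - \sum_a \sum_e K a d e * K e a b.
  rewrite /ric big_split /= sumrB -[RHS]addrA; congr (_ + _).
  under eq_bigr do rewrite sumrB.
  rewrite sumrB; congr (_ - _); rewrite exchange_big /=.
  by apply: eq_bigr => e _; rewrite mulr_suml.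
(* The two deltas contribute n + 1 copies of [u e], and the term with the metric takes one away. *)
have t' e : \sum_a C' a a e = t e + n%:R * u e.
  rewrite sumrB !big_split /= -(gv e) -/(t e).
  under [X in _ + X + _ - _]eq_bigr do rewrite eqxx mul1r.
  rewrite sum_delta_l sumr_const card_ord.
  have -> : \sum_a v a * g a e = u e.
    by rewrite -gv; apply: eq_bigr => a _; rewrite gs mulrC.
  rewrite gv; ring.
have r1 : \sum_a dC' a a d b = \sum_a dC a a d b + 2 * ddu d b
    - (\sum_a dv a a * g d b + \sum_a v a * dg a d b).
  rewrite sumrB !big_split /= !sum_delta_l (dds b d); ring.
have r2 : \sum_a dC' d a a b = \sum_a dC d a a b + n%:R * ddu d b.
  rewrite sumrB !big_split /=.
  under [X in _ + X + _ - _]eq_bigr do rewrite eqxx mul1r.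
  rewrite sum_delta_l sumr_const card_ord -big_split /=.
  have -> : \sum_i (dv d i * g i b + v i * dg d i b) = ddu d b.
    by rewrite -dgv; apply: eq_bigr => a _; ring.
  ring.
have r3 : \sum_e (\sum_a C' a a e) * C' e d b = \sum_e t e * C e d b
    + t d * u b + t b * u d - g d b * \sum_e t e * v e
    + n%:R * (\sum_e C e d b * u e + 2 * (u d * u b) - g d b * N).
  transitivity (\sum_e (t e * C e d b + (e == d)%:R * (t e * u b)
     + (e == b)%:R * (t e * u d) - g d b * (t e * v e)
     + n%:R * (C e d b * u e + (e == d)%:R * (u e * u b)
     + (e == b)%:R * (u e * u d) - g d b * (v e * u e)))).
    by apply: eq_bigr => e _; rewrite t' /C'; ring.
  rewrite !big_split /= sumrN !sum_delta_l -!mulr_sumr.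
  rewrite !big_split /= sumrN !sum_delta_l -!mulr_sumr -/N; ring.
have r4 : \sum_a \sum_e C' a d e * C' e a b = \sum_a \sum_e C a d e * C e a b
    + u b * t d + u d * t b + 2 * \sum_e C e d b * u e
    - \sum_a v a * dg a d b + (n%:R + 2) * (u d * u b) - 2 * (g d b * N).
  rewrite [LHS]contract_left.
  have tC c : \sum_a C a c a = t c by apply: eq_bigr => a _; rewrite Cs.
  have e1 : \sum_a \sum_e C a d e * C' e a b = \sum_a \sum_e C a d e * C e a b
      + u b * t d + \sum_e C e d b * u e
      - \sum_a \sum_e v e * g a b * C a d e.
    rewrite contract_right tC; congr (_ + _ - _).
    by apply: eq_bigr => a _; rewrite mulrC.
  have e2 : \sum_e u e * C' e d b
      = \sum_e C e d b * u e + 2 * (u d * u b) - g d b * N.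
    transitivity (\sum_e (C e d b * u e + (e == d)%:R * (u e * u b)
        + (e == b)%:R * (u e * u d) - g d b * (v e * u e))).
      by apply: eq_bigr => e _; rewrite /C'; ring.
    by rewrite !big_split /= sumrN !sum_delta_l -!mulr_sumr -/N; ring.
  have gvl c : \sum_a v a * g c a = u c.
    by rewrite -gv; apply: eq_bigr => a _; rewrite mulrC.
  have gvr c : \sum_a v a * g a c = u c.
    by rewrite -gv; apply: eq_bigr => a _; rewrite mulrC gs.
  have e4 : \sum_a \sum_e v a * g d e * C' e a b
      = \sum_a \sum_e v a * g d e * C e a b + g d b * N.
    rewrite contract_right gvl.
    have -> : \sum_a u a * (v a * g d b) = g d b * N.
      by rewrite mulr_sumr; apply: eq_bigr => a _; ring.
    have -> : \sum_a \sum_e v e * g a b * (v a * g d e) = u b * u d.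
      rewrite -gvr mulr_suml; apply: eq_bigr => a _.
      by rewrite -gvl mulr_sumr; apply: eq_bigr => e _; ring.
    ring.
  (* Metric compatibility gathers the two remaining cross terms into a derivative of the metric,
     which cancels the one in [r1]. *)
  have e5 : \sum_a v a * dg a d b = \sum_a \sum_e v e * g a b * C a d e
      + \sum_a \sum_e v a * g d e * C e a b.
    rewrite [X in _ = X + _]exchange_big -big_split; apply: eq_bigr => a _ /=.
    rewrite dgE -big_split mulr_sumr; apply: eq_bigr => e _ /=.
    by rewrite (Cs e d a); ring.
  rewrite e1 e2 t' e4 e5; ring.
rewrite !ricE r1 r2 r3 r4 -mulr_suml /div.
have -> : \sum_a (dv a a + \sum_e C a a e * v e)
    = \sum_a dv a a + \sum_e t e * v e.
  rewrite big_split exchange_big /=; congr (_ + _).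
  by apply: eq_bigr => e _; rewrite mulr_suml.
rewrite -/t; ring.
Qed.

End ConformalAlgebra.

(** * The Lie derivative of the metric along a raised covector *)

Section LieDerivative.
Context {R : realType} {n : nat}.
Variables (V : set 'rV[R]_n) (g : 'rV[R]_n -> 'M[R]_n).
Hypotheses (oV : open V) (sg : smooth_mx V g).
Hypotheses (gT : forall y, V y -> (g y)^T = g y).
Hypotheses (gu : forall y, V y -> g y \in unitmx).
Variable w : 'rV[R]_n -> 'I_n -> R.
Hypothesis sw : forall a, smooth_on V (fun y => w y a).
Implicit Types (x y : 'rV[R]_n) (a b c d e : 'I_n).

Definition sharp y : 'rV[R]_n := \row_a \sum_b invmx (g y) a b * w y b.

Lemma smooth_sharp c : smooth_on V (fun y => sharp y 0 c).
Proof.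
under eq_fun do rewrite mxE; apply: smooth_on_sum => // e.
by apply: smooth_onM => //; exact: (smooth_inverse_metric oV).
Qed.

Lemma metric_sharp y b : V y -> \sum_c g y b c * sharp y 0 c = w y b.
Proof.
move=> Vy; under eq_bigr do rewrite mxE mulr_sumr.
rewrite exchange_big /= -(sum_delta_l (w y) b); apply: eq_bigr => e _.
have /matrixP /(_ b e) := mulmxV (gu Vy); rewrite !mxE eq_sym => <-.
by rewrite mulr_suml; apply: eq_bigr => c _; rewrite mulrA.
Qed.

(** Once [w] is written as [g] applied to [sharp], both sides are sums over one index, linear in the
    vector field and its derivatives, and agree term by term. *)
Lemma lie_metric_sharp x a b : V x ->
  lie_tensor2 sharp g x a b = nabla1 g w x a b + nabla1 g w x b a.
Proof.
move=> Vx; rewrite mxE /lie_fun.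
have sgd i j := smooth_mx_diff i j sg Vx.
have dX c := smooth_on_diff (smooth_sharp c) Vx.
have dw i j : partial i (fun y => w y j) x = \sum_c
    (partial i (fun y => g y j c) x * sharp x 0 c
     + g x j c * partial i (fun y => sharp y 0 c) x).
  transitivity (partial i (fun y => \sum_c g y j c * sharp y 0 c) x).
    by apply: (partial_ext _ oV Vx) => y Vy; rewrite metric_sharp.
  rewrite partial_sum; last by move=> c; exact: differentiableM.
  by apply: eq_bigr => c _; exact: partialM.
have chr i j : \sum_e christoffel g x e i j * w x e = \sum_f 2^-1 *
    (partial i (fun y => g y f j) x + partial j (fun y => g y f i) x
     - partial f (fun y => g y i j) x) * sharp x 0 f.
  transitivity (\sum_f (Gam g i x *m g x) j f * sharp x 0 f); last first.
    by apply: eq_bigr => f _; rewrite (christoffel_low gT gu).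
  under [RHS]eq_bigr do rewrite mxE mulr_suml.
  rewrite exchange_big; apply: eq_bigr => e _ /=.
  by rewrite -metric_sharp// mulr_sumr GamE; apply: eq_bigr => f _; rewrite mulrA.
have P (i j k : 'I_n) :
    partial i (fun y => g y j k) x = partial i (fun y => g y k j) x.
  by apply: (partial_ext _ oV Vx) => y Vy; exact: (metric_sym gT).
rewrite /nabla1 !chr !dw -!sumrB -!big_split; apply: eq_bigr => c _.
rewrite (metric_sym gT c b Vx) (P c b a) (P a b c) (P b a c) /=.
by abstract_atoms => *; lra.
Qed.

End LieDerivative.

(** The argument order is the one in which [sharp] and [nabla1] expect a covector field. *)
HB.lock Definition dcov (R : realType) (n : nat) (u : 'rV[R]_n -> R)
    (y : 'rV[R]_n) (a : 'I_n) : R := partial a u y.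

Lemma dcovE (R : realType) n (u : 'rV[R]_n -> R) a :
  (fun y => dcov u y a) = partial a u.
Proof. by rewrite dcov.unlock. Qed.

(** * Christoffel symbols, Ricci tensor and Lie derivative of a conformal metric *)

Section Conformal.
Context {R : realType} {n : nat}.
Variables (V : set 'rV[R]_n) (g : 'rV[R]_n -> 'M[R]_n) (u : 'rV[R]_n -> R).
Hypotheses (oV : open V) (sg : smooth_mx V g) (su : smooth_on V u).
Hypotheses (gT : forall y, V y -> (g y)^T = g y).
Hypotheses (gu : forall y, V y -> g y \in unitmx).
Implicit Types (x y : 'rV[R]_n) (a b c d e : 'I_n).

Local Notation h := (fun y => expR (2 * u y) *: g y).
Local Notation G y := (invmx (g y)).

Local Notation dcov := (dcov u).
Definition grad : 'rV[R]_n -> 'rV[R]_n := sharp g dcov.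
Definition grad_sq y : R := \sum_a grad y 0 a * dcov y a.
(** The Laplace-Beltrami operator applied to [u]. *)
Definition div_grad y : R := \sum_a (partial a (fun y => grad y 0 a) y
  + \sum_e christoffel g y a a e * grad y 0 e).

Lemma smooth_dcov a : smooth_on V (fun y => dcov y a).
Proof. by rewrite dcovE; exact: smooth_on_partial. Qed.

Lemma smooth_grad a : smooth_on V (fun y => grad y 0 a).
Proof. exact: (smooth_sharp oV sg gu smooth_dcov). Qed.

Lemma partial_exp2 y c : V y ->
  partial c (fun z => expR (2 * u z)) y = 2 * dcov y c * expR (2 * u y).
Proof.
move=> Vy; have du := smooth_on_diff su Vy.
have d2 : differentiable (fun=> 2 : R) y by exact: differentiable_cst.
rewrite (partial_comp c (differentiableM d2 du) (@derivable_expR R (2 * u y))).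
by rewrite derive1E derive_val (partialZ 2 c du) -[partial c u]dcovE mulrC.
Qed.

Lemma diff_exp2 y : V y -> differentiable (fun z => expR (2 * u z)) y.
Proof.
move=> Vy; apply: (@smooth_on_diff _ _ V) => //.
by apply: smooth_on_exp => //; apply: smooth_onM => //; exact: smooth_on_cst.
Qed.

Lemma partial_conformal y c a b : V y ->
  partial c (fun z => h z a b) y
  = expR (2 * u y) * (2 * dcov y c * g y a b + partial c (fun z => g z a b) y).
Proof.
move=> Vy; under eq_fun do rewrite mxE.
rewrite (partialM c (diff_exp2 Vy) (smooth_mx_diff a b sg Vy)) partial_exp2//.
by abstract_atoms => *; ring.
Qed.

Lemma christoffel_conformal y d a b : V y ->
  christoffel h y d a b = christoffel g y d a b + (d == a)%:R * dcov y b
    + (d == b)%:R * dcov y a - grad y 0 d * g y a b.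
Proof.
move=> Vy; rewrite /christoffel.
have E0 : expR (2 * u y) != 0 :> R by rewrite gt_eqF// expR_gt0.
have GE e : invmx (h y) d e = (expR (2 * u y))^-1 * G y d e.
  rewrite (_ : invmx (h y) = (expR (2 * u y))^-1 *: G y) ?mxE//.
  by rewrite invmxZ// unitmxZ ?unitfE// gu.
have Gg f : \sum_e G y d e * g y e f = (d == f)%:R.
  by have /matrixP /(_ d f) := mulVmx (gu Vy); rewrite !mxE.
rewrite -!Gg [grad y 0 d]mxE.
transitivity (\sum_e (2^-1 * (G y d e * (partial a (fun z => g z e b) y
     + partial b (fun z => g z e a) y - partial e (fun z => g z a b) y))
   + G y d e * g y e a * dcov y b + G y d e * g y e b * dcov y a
   - G y d e * dcov y e * g y a b)).
  rewrite mulr_sumr; apply: eq_bigr => e _; rewrite GE !partial_conformal//.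
  rewrite -mulrDr -mulrBr mulrACA mulVf// mul1r.
  by abstract_atoms => *; lra.
by rewrite !big_split /= sumrN -!mulr_suml -mulr_sumr.
Qed.

Lemma partial_dcov_sym y a b : V y ->
  partial a (fun z => dcov z b) y = partial b (fun z => dcov z a) y.
Proof. by move=> Vy; rewrite !dcovE; exact: (partial_commute a b oV su Vy). Qed.

Lemma partial_christoffel_conformal y c a d b : V y ->
  partial c (fun z => christoffel h z a d b) y
  = partial c (fun z => christoffel g z a d b) y
    + (a == d)%:R * partial c (fun z => dcov z b) y
    + (a == b)%:R * partial c (fun z => dcov z d) y
    - (partial c (fun z => grad z 0 a) y * g y d b
       + grad y 0 a * partial c (fun z => g z d b) y).
Proof.
move=> Vy.
have dC := smooth_on_diff (smooth_christoffel oV sg gu d b a) Vy.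
have dd e := smooth_on_diff (smooth_dcov e) Vy.
have dv := smooth_on_diff (smooth_grad a) Vy.
have dgm := smooth_mx_diff d b sg Vy.
have dk (k : R) : differentiable (fun=> k) y by exact: differentiable_cst.
have D1 := differentiableM (dk (a == d)%:R) (dd b).
have D2 := differentiableM (dk (a == b)%:R) (dd d).
have D3 := differentiableM dv dgm.
transitivity (partial c (fun z => christoffel g z a d b + (a == d)%:R * dcov z b
  + (a == b)%:R * dcov z d + - (grad z 0 a * g z d b)) y).
  by apply: (partial_ext _ oV Vy) => z Vz; exact: christoffel_conformal.
rewrite (partialD c (differentiableD (differentiableD dC D1) D2) (differentiableN D3)).
rewrite (partialD c (differentiableD dC D1) D2) (partialD c dC D1).
rewrite (partialN c D3) (partialM c dv dgm).
by rewrite (partialZ (a == d)%:R c (dd b)) (partialZ (a == b)%:R c (dd d)).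
Qed.

Lemma metric_grad y b : V y -> \sum_c g y b c * grad y 0 c = dcov y b.
Proof. exact: metric_sharp. Qed.

Lemma ricciE_sum (f : 'rV[R]_n -> 'M[R]_n) y b d : ricci f y b d =
  \sum_a (partial a (fun z => christoffel f z a d b) y
          - partial d (fun z => christoffel f z a a b) y
          + \sum_e (christoffel f y a a e * christoffel f y e d b
                    - christoffel f y a d e * christoffel f y e a b)).
Proof. by rewrite mxE. Qed.

Lemma ricci_conformal y b d : V y ->
  ricci h y b d = ricci g y b d
    - (n%:R - 2) * (nabla1 g dcov y d b - dcov y d * dcov y b)
    - (div_grad y + (n%:R - 2) * grad_sq y) * g y d b.
Proof.
move=> Vy; rewrite !ricciE_sum.
have := @conformal_ricci_algebra R n (christoffel g y)
  (fun c a d b => partial c (fun z => christoffel g z a d b) y) (g y)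
  (fun c b => partial c (fun z => dcov z b) y)
  (fun c a => partial c (fun z => grad z 0 a) y)
  (fun c a b => partial c (fun z => g z a b) y) (dcov y) (grad y 0).
move=> /(_ _ _ _ _ _ _ b d) H; rewrite -[RHS]H; last first.
- by move=> c p q; exact: (partial_metric oV gT gu).
- move=> c p; symmetry.
  have sgd i j := smooth_mx_diff i j sg Vy.
  have dv e := smooth_on_diff (smooth_grad e) Vy.
  transitivity (partial c (fun z => \sum_a g z a p * grad z 0 a) y).
    apply: (partial_ext _ oV Vy) => z Vz; rewrite -metric_grad//.
    by apply: eq_bigr => e _; rewrite (metric_sym gT p e Vz).
  rewrite partial_sum; last by move=> e; exact: differentiableM.
  by apply: eq_bigr => e _; exact: partialM.
- by move=> p; exact: metric_grad.
- by move=> p q; exact: partial_dcov_sym.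
- by move=> p q; exact: (metric_sym gT).
- by move=> p q r; exact: (christoffel_sym oV gT).
apply: eq_bigr => a _; congr (_ - _ + _).
- exact: partial_christoffel_conformal.
- exact: partial_christoffel_conformal.
by apply: eq_bigr => e _; rewrite !christoffel_conformal.
Qed.

Lemma lie_conformal (X : 'rV[R]_n -> 'rV[R]_n) y a b : V y ->
  lie_tensor2 X h y a b
  = expR (2 * u y) * (2 * lie_fun X u y * g y a b + lie_tensor2 X g y a b).
Proof.
move=> Vy; rewrite [LHS]mxE [lie_tensor2 X g y a b]mxE /lie_fun.
have -> : \sum_c X y 0 c * partial c (fun z => h z a b) y
    = expR (2 * u y) * (2 * (\sum_c X y 0 c * partial c u y) * g y a b
                        + \sum_c X y 0 c * partial c (fun z => g z a b) y).
  rewrite mulr_sumr mulr_suml -big_split mulr_sumr.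
  apply: eq_bigr => c _ /=; rewrite partial_conformal// -[partial c u]dcovE.
  by abstract_atoms => *; ring.
rewrite [in RHS]addrA [RHS]mulrDr; congr (_ + _); rewrite mulr_sumr.
by apply: eq_bigr => c _; rewrite ![(_ *: g y) _ _]mxE; ring.
Qed.

End Conformal.

(** * The soliton equation in a chart *)

Lemma scale_delta_rowE (R : pzRingType) n (A : 'rV[R]_n) k l c a :
  (k *: A + l *: delta_mx 0 c) 0 a = k * A 0 a + l * (a == c)%:R.
Proof. by rewrite !mxE eqxx. Qed.

Section LocalCKYRS.
Context {R : realType} {n : nat}.
Variables (V : set 'rV[R]_n) (g : 'rV[R]_n -> 'M[R]_n) (u : 'rV[R]_n -> R).
Variables (X : 'rV[R]_n -> 'rV[R]_n) (L lam : R).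
Hypotheses (oV : open V) (sg : smooth_mx V g) (su : smooth_on V u).
Hypotheses (gT : forall y, V y -> (g y)^T = g y).
Hypotheses (gu : forall y, V y -> g y \in unitmx).
Hypotheses (n_ge3 : (3 <= n)%N) (sX : forall c, smooth_on V (fun y => X y 0 c)).
Hypothesis ricg : forall y, V y -> ricci g y = L *: g y.
Hypothesis lieX : forall y, V y -> lie_tensor2 X g y = 0.
Local Notation h := (fun y => expR (2 * u y) *: g y).
Hypothesis rs : forall y, V y ->
  ricci h y + 2^-1 *: lie_tensor2 X h y = lam *: h y.
Implicit Types (x y : 'rV[R]_n) (a b c d e : 'I_n).

Local Notation G y := (invmx (g y)).
Local Notation dcov := (dcov u).
Local Notation grad := (grad g u).
Local Notation N := (grad_sq g u).
Local Notation S := (lie_fun X u).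

(** As [X] is Killing for [g], this factor times [g] is half the Lie derivative of the conformal
    metric minus [lam] times that metric. *)
Definition soliton_defect y : R := (S y - lam) * expR (2 * u y).
Local Notation W := soliton_defect.

(* Nabla du = du (x) du + hess_trace g *)
Definition hess_trace y : R :=
  (n%:R - 2)^-1 * (L - div_grad g u y - (n%:R - 2) * N y + W y).
Local Notation chi := hess_trace.

Let n2 : (n%:R - 2 : R) != 0.
Proof. by rewrite subr_eq0 eqr_nat; apply: contraTneq n_ge3 => ->. Qed.

Let sgrad a : smooth_on V (fun y => grad y 0 a).
Proof. exact: smooth_grad. Qed.

Let sdcov a : smooth_on V (fun y => dcov y a).
Proof. exact: smooth_dcov. Qed.

Lemma smooth_grad_sq : smooth_on V N.
Proof. by apply: smooth_on_sum => // a; exact: smooth_onM. Qed.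

Lemma smooth_lie_fun : smooth_on V S.
Proof.
apply: smooth_on_sum => // c; apply: smooth_onM => //.
exact: smooth_on_partial.
Qed.

Lemma smooth_soliton_defect : smooth_on V W.
Proof.
apply: smooth_onM => //.
  by apply: smooth_onB => //; [exact: smooth_lie_fun|exact: smooth_on_cst].
by apply: smooth_on_exp => //; apply: smooth_onM => //; exact: smooth_on_cst.
Qed.

Lemma smooth_hess_trace : smooth_on V chi.
Proof.
have sc (k : R) : smooth_on V (fun=> k) by exact: smooth_on_cst.
apply: smooth_onM => //; apply: smooth_onD => //; last first.
  exact: smooth_soliton_defect.
apply: smooth_onB => //; last by apply: smooth_onM => //; exact: smooth_grad_sq.
apply: smooth_onB => //; apply: smooth_on_sum => // a; apply: smooth_onD => //.
  exact/smooth_on_partial/sgrad.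
apply: smooth_on_sum => // e; apply: smooth_onM => //.
exact: (smooth_christoffel oV sg gu).
Qed.

(** The soliton equation solved for the Hessian, dividing by n - 2. At this stage [chi] still
    contains the Laplacian; the trace is taken in [div_gradE]. *)
Lemma hessE y d b : V y ->
  nabla1 g dcov y d b = dcov y d * dcov y b + chi y * g y d b.
Proof.
move=> Vy; have /matrixP /(_ b d) := rs Vy.
rewrite [LHS]mxE [X in _ + X]mxE [RHS]mxE.
rewrite (ricci_conformal oV sg su gT gu) // ricg// (lie_conformal oV sg su)//.
have l0 : (0 : 'M[R]_n) b d = 0 by rewrite mxE.
have sE k (A : 'M[R]_n) i j : (k *: A) i j = k * A i j by rewrite mxE.
rewrite lieX// l0 !sE (metric_sym gT b d Vy) => E.
suff H : (n%:R - 2) * (nabla1 g dcov y d b - dcov y d * dcov y b)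
       = (L - div_grad g u y - (n%:R - 2) * N y + W y) * g y d b.
  apply/eqP; rewrite addrC -subr_eq; apply/eqP; apply: (mulfI n2).
  by rewrite H /hess_trace -[_^-1 * _ * _]mulrA mulVKf.
rewrite /soliton_defect; move: E.
move: (nabla1 _ _ _ _ _) (div_grad _ _ _) (N y) (g y d b) => H D N0 gdb.
by move: (S y) (dcov y d) (dcov y b) (expR _) => s ud ub ex E; lra.
Qed.

(* nabla_c of the gradient vector field *)
Definition Dgrad c y : 'rV[R]_n := mpartial c grad y + grad y *m Gam g c y.

Lemma DgradE c y a : Dgrad c y 0 a = partial c (fun z => grad z 0 a) y
  + \sum_e christoffel g y a c e * grad y 0 e.
Proof.
rewrite mxE mpartialE; congr (_ + _); rewrite mxE; apply: eq_bigr => e _.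
by rewrite GamE mulrC.
Qed.

Lemma Dgrad_hess c y : V y ->
  Dgrad c y = dcov y c *: grad y + chi y *: delta_mx 0 c.
Proof.
move=> Vy; pose w z : 'rV[R]_n := \row_a dcov z a.
have wE z : V z -> grad z = w z *m G z.
  move=> Vz; apply/rowP => a; rewrite !mxE; apply: eq_bigr => b _.
  by rewrite mxE mulrC (inverse_metric_sym gT a b Vz).
have sw : smooth_mx V w.
  by move=> i a; under eq_fun do rewrite mxE; exact: sdcov.
have sG : smooth_mx V (fun z => G z) by exact: (smooth_inverse_metric oV).
have -> : Dgrad c y = (mpartial c w y - w y *m (Gam g c y)^T) *m G y.
  rewrite /Dgrad (mpartial_ext oV c Vy wE) (mpartialM c sw sG Vy).
  rewrite (mpartial_inverse_metric oV sg gT gu c Vy) wE//.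
  by move: (w y) (G y) (Gam g c y) => A B C; mxabel.
have -> : mpartial c w y - w y *m (Gam g c y)^T
    = dcov y c *: w y + chi y *: (delta_mx 0 c *m g y).
  apply/rowP => b; rewrite -rowE.
  have := hessE c b Vy; rewrite /nabla1 => E.
  rewrite [RHS]mxE [X in _ = X + _]mxE [X in _ = _ + X]mxE.
  rewrite [w y 0 b]mxE [row c _ 0 b]mxE -E [LHS]mxE mpartialE; congr (_ + _).
    by congr (partial c _ y); apply/funext => z; rewrite mxE.
  rewrite mxE [X in - X]mxE; congr (- _); apply: eq_bigr => e _.
  by rewrite mxE [(_)^T _ _]mxE GamE mulrC.
by rewrite mulmxDl -!scalemxAl -wE// -mulmxA mulmxV ?mulmx1// gu.
Qed.

Lemma div_gradE y : V y -> div_grad g u y = N y + n%:R * chi y.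
Proof.
move=> Vy; rewrite /div_grad.
transitivity (\sum_(a < n) (grad y 0 a * dcov y a + chi y)).
  apply: eq_bigr => a _; rewrite -DgradE Dgrad_hess// scale_delta_rowE.
  by rewrite eqxx mulr1 mulrC.
by rewrite big_split /= sumr_const card_ord mulr_natl.
Qed.

Lemma soliton_defectE y : V y -> W y = (n%:R * 2 - 2) * chi y + (n%:R - 1) * N y - L.
Proof.
move=> Vy; have : (n%:R - 2) * chi y = L - div_grad g u y - (n%:R - 2) * N y + W y.
  by rewrite mulVKf.
by rewrite div_gradE//; move: (chi y) (W y) (N y) => c w k E; lra.
Qed.

Lemma partial_grad_sq c y : V y ->
  partial c N y = 2 * (N y + chi y) * dcov y c.
Proof.
move=> Vy.
have dg a := smooth_on_diff (sgrad a) Vy.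
have dd a := smooth_on_diff (sdcov a) Vy.
rewrite partial_sum; last by move=> a; exact: differentiableM.
under eq_bigr do rewrite (partialM c (dg _) (dd _)).
have gd : \sum_a grad y 0 a * g y c a = dcov y c.
  by rewrite -(metric_grad u gu)//; apply: eq_bigr => a _; rewrite mulrC.
(* The corrections for the gradient and for du cancel, so the scalar [N] may be differentiated
   covariantly. *)
have sym : \sum_a (\sum_e christoffel g y a c e * grad y 0 e) * dcov y a
    = \sum_a grad y 0 a * \sum_e christoffel g y e c a * dcov y e.
  under eq_bigr do rewrite mulr_suml.
  rewrite exchange_big; apply: eq_bigr => e _; rewrite mulr_sumr.
  by apply: eq_bigr => a _; ring.
transitivity (\sum_a (Dgrad c y 0 a * dcov y a + grad y 0 a * nabla1 g dcov y c a)).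
  apply/eqP; rewrite -subr_eq0 -sumrB; apply/eqP.
  transitivity (\sum_a (grad y 0 a * \sum_e christoffel g y e c a * dcov y e)
     - \sum_a (\sum_e christoffel g y a c e * grad y 0 e) * dcov y a).
    by rewrite -sumrB; apply: eq_bigr => a _; rewrite DgradE /nabla1; ring.
  by rewrite sym subrr.
transitivity (\sum_a (2 * dcov y c * (grad y 0 a * dcov y a)
   + chi y * ((a == c)%:R * dcov y a) + chi y * (grad y 0 a * g y c a))).
  by apply: eq_bigr => a _; rewrite hessE// Dgrad_hess// scale_delta_rowE; ring.
by rewrite !big_split /= -!mulr_sumr gd sum_delta_l -/(N y); ring.
Qed.

(** The Ricci identity for the gradient field, again with [c] and [d] as uncorrected labels. *)
Lemma Dgrad_commute c d y : V y ->
  mpartial d (Dgrad c) y - mpartial c (Dgrad d) y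
    + Dgrad c y *m Gam g d y - Dgrad d y *m Gam g c y
  = grad y *m Om g d c y.
Proof.
move=> Vy.
have smg : smooth_mx V grad by move=> i a; rewrite (ord1 i); exact: sgrad.
have sGm e : smooth_mx V (Gam g e) by exact: (smooth_Gam oV).
have E e f : mpartial e (Dgrad f) y = mpartial e (mpartial f grad) y
    + (mpartial e grad y *m Gam g f y + grad y *m mpartial e (Gam g f) y).
  rewrite /Dgrad (mpartialD e (V := V))//.
  - by rewrite (mpartialM e smg (sGm f) Vy).
  - exact: smooth_mx_mpartial.
  - exact: smooth_mxM.
rewrite !E (mpartial_commute oV c d smg Vy) (OmE g d c Vy) /Dgrad.
move: (grad y) (Gam g c y) (Gam g d y) => A B C; mxabel.
Qed.

Lemma partial_hess_trace c y : V y ->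
  (n%:R - 1) * (partial c chi y - chi y * dcov y c) = - L * dcov y c.
Proof.
move=> Vy.
have dx := smooth_on_diff smooth_hess_trace Vy.
have dg a := smooth_on_diff (sgrad a) Vy.
have dd a := smooth_on_diff (sdcov a) Vy.
(* A single entry, not yet summed. Summing over [d] gives the Ricci tensor on the left, while on the
   right the delta leaves one copy of the bracket at [c] against n copies: hence the factor n -
   1. *)
have K d : (grad y *m Om g d c y) 0 d
    = (partial d chi y - chi y * dcov y d) * (d == c)%:R
      - (partial c chi y - chi y * dcov y c).
  rewrite -Dgrad_commute//.
  have P e f : mpartial e (Dgrad f) y 0 d
      = partial e (fun z => dcov z f) y * grad y 0 d
        + dcov y f * partial e (fun z => grad z 0 d) y
        + partial e chi y * (d == f)%:R.
    rewrite mpartialE.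
    have dk : differentiable (fun=> (d == f)%:R : R) y.
      exact: differentiable_cst.
    transitivity (partial e (fun z => dcov z f * grad z 0 d
                                       + (d == f)%:R * chi z) y).
      apply: (partial_ext _ oV Vy) => z Vz.
      by rewrite Dgrad_hess// scale_delta_rowE [chi z * _]mulrC.
    have dM := differentiableM (dd f) (dg d).
    rewrite (partialD e dM (differentiableM dk dx)) (partialZ _ e dx).
    by rewrite (partialM e (dd f) (dg d)) [(d == f)%:R * _]mulrC.
  have Q e f : (Dgrad f y *m Gam g e y) 0 d
      = dcov y f * (grad y *m Gam g e y) 0 d + chi y * christoffel g y d e f.
    rewrite Dgrad_hess// mulmxDl -!scalemxAl -rowE -GamE.
    by move: (grad y *m _) => A; rewrite !mxE.
  have T e : partial e (fun z => grad z 0 d) y + (grad y *m Gam g e y) 0 d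
      = dcov y e * grad y 0 d + chi y * (d == e)%:R.
    have /rowP /(_ d) := Dgrad_hess e Vy; rewrite /Dgrad mxE mpartialE => ->.
    by rewrite scale_delta_rowE.
  have entry (A B C D : 'rV[R]_n) :
    (A - B + C - D) 0 d = A 0 d - B 0 d + C 0 d - D 0 d by rewrite !mxE.
  rewrite entry !P !Q (partial_dcov_sym oV su d c Vy).
  rewrite (christoffel_sym oV gT d c d Vy).
  (* [one] is [(d == d)%:R]; the other two hypotheses are instances of [T] and eliminate the
     derivatives of the gradient. *)
  have alg (uc ud k del one v w vd vc gd gc dk ck q : R) : one = 1 ->
      vd + gd = ud * v + k * one -> vc + gc = uc * v + k * del ->
      w * v + uc * vd + dk * del - (w * v + ud * vc + ck * one)
        + (uc * gd + k * q) - (ud * gc + k * q)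
      = (dk - k * ud) * del - (ck - k * uc).
    move=> -> /(canRL (addrK _)) -> /(canRL (addrK _)) ->; ring.
  by apply: alg (T d) (T c); rewrite eqxx.
have : \sum_d (grad y *m Om g d c y) 0 d = L * dcov y c.
  under eq_bigr do rewrite mxE.
  rewrite exchange_big /= -(metric_grad u gu)// mulr_sumr; apply: eq_bigr => e _.
  have sE (A : 'M[R]_n) i j : (L *: A) i j = L * A i j by rewrite mxE.
  by rewrite -mulr_sumr -ricciE ricg// sE (metric_sym gT e c Vy); ring.
under eq_bigr do rewrite K mulrC.
rewrite sumrB sum_delta_l sumr_const card_ord -mulr_natl.
by move: (partial c chi y) => cc E; rewrite mulNr -E; ring.
Qed.

Lemma partial_lie_fun c y : V y -> partial c S y = 0.
Proof.
move=> Vy.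
have dx := smooth_on_diff smooth_hess_trace Vy.
have dN := smooth_on_diff smooth_grad_sq Vy.
have dS := smooth_on_diff smooth_lie_fun Vy.
have dk (k : R) : differentiable (fun=> k) y by exact: differentiable_cst.
(* The coefficient of du is (2n - 2)(chi - L/(n - 1)) + 2(n - 1)(N + chi), which equals 2 W. The
   product rule below yields this same term plus [expR (2 * u y)] times the derivative of [S], which
   must therefore vanish. *)
have dW : partial c W y = 2 * dcov y c * W y.
  transitivity (partial c (fun z => (n%:R * 2 - 2) * chi z + (n%:R - 1) * N z
      + (- L)) y).
    by apply: (partial_ext _ oV Vy) => z Vz; exact: soliton_defectE.
  have d1 := differentiableM (dk (n%:R * 2 - 2)) dx.
  have d2 := differentiableM (dk (n%:R - 1)) dN.
  rewrite (partialD c (differentiableD d1 d2) (dk _)) (partialD c d1 d2).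
  rewrite (partialZ _ c dx) (partialZ _ c dN) partial_cst partial_grad_sq//.
  rewrite soliton_defectE//; have := partial_hess_trace c Vy.
  by move: (partial c chi y) (chi y) (N y) (dcov y c) => cc ch k uc E; lra.
have : partial c W y = partial c S y * expR (2 * u y) + 2 * dcov y c * W y.
  have dSl : differentiable (fun z => S z - lam) y.
    exact: differentiableD dS (dk (- lam)).
  rewrite [LHS](partialM c dSl (diff_exp2 oV su Vy)) (partialD c dS (dk _)).
  by rewrite partial_cst addr0 (partial_exp2 su)// /soliton_defect; ring.
rewrite dW => /eqP; rewrite -subr_eq subrr eq_sym mulf_eq0 => /orP[/eqP //|].
by rewrite gt_eqF// expR_gt0.
Qed.

End LocalCKYRS.

(** * Comparison of charts and connectedness *)

Section ChangeOfVariables.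
Context {R : realType} {n : nat}.
Implicit Types (f : 'rV[R]_n -> R) (F : 'rV[R]_n -> 'rV[R]_n) (x : 'rV[R]_n).

Lemma differentiable_row F x :
  (forall k, differentiable (fun y => F y 0 k) x) -> differentiable F x.
Proof.
move=> dF.
have -> : F = \sum_(k < n) (fun y => F y 0 k *: (delta_mx 0 k : 'rV[R]_n)).
  apply/funext => y; rewrite {1}(row_sum_delta (F y)).
  by elim/big_ind2 : _ => // [A _ B _ -> ->].
by apply: differentiable_sum => k; exact: differentiableZl.
Qed.

Lemma partial_jacobian F f x a :
  differentiable F x -> differentiable f (F x) ->
  partial a (fun y => f (F y)) x
  = \sum_k jacobian F x a k * partial k f (F x).
Proof.
move=> dF df; have dfF := differentiable_comp dF df.
rewrite /partial deriveE // (diff_comp dF df) /= -deriveE // deriveE_partial//.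
by apply: eq_bigr => k _; rewrite -[RHS]/(_ * _) /jacobian [in RHS]mxE.
Qed.

Lemma lie_fun_grad0 (X : 'rV[R]_n -> 'rV[R]_n) f x :
  (forall a, dcov f x a = 0) -> lie_fun X f x = 0.
Proof.
move=> f0; rewrite /lie_fun big1// => c _.
by have := f0 c; rewrite dcov.unlock => ->; rewrite mulr0.
Qed.

Lemma grad_sqE (g : 'rV[R]_n -> 'M[R]_n) f x :
  let w := \row_a dcov f x a : 'rV[R]_n in
  grad_sq g f x = (w *m (invmx (g x))^T *m w^T) 0 0.
Proof.
rewrite /= /grad_sq mxE; apply: eq_bigr => a _; congr (_ * _); last by rewrite !mxE.
by rewrite !mxE; apply: eq_bigr => b _; rewrite !mxE mulrC.
Qed.

(** Invariance of the inverse quadratic form under change of coordinates. Invertibility of the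
    Jacobian [J] is read off from that of the metric [A]. *)
Lemma sq_norm_congruence (A B J : 'M[R]_n) (w z : 'rV[R]_n) :
  A \in unitmx -> A = J *m B *m J^T -> z = w *m J^T ->
  z *m (invmx A)^T *m z^T = w *m (invmx B)^T *m w^T.
Proof.
move=> uA AE ->; have := uA; rewrite AE !unitmx_mul unitmx_tr => /andP[/andP[uJ uB] _].
have E : J^T *m invmx A *m J = invmx B.
  rewrite -[LHS](mulmxK uB) -[J^T *m _ *m J *m B]mulmxA.
  have -> : J *m B = A *m invmx J^T by rewrite AE mulmxK// unitmx_tr.
  rewrite -[J^T *m _ *m _]mulmxA (mulKmx uA) mulmxV ?unitmx_tr//.
  by rewrite mul1mx.
by rewrite -AE -E !trmx_mul !trmxK !mulmxA.
Qed.

End ChangeOfVariables.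

(** * Transformation of du, of its squared norm and of the derivative of that norm *)

Section ChartIndependence.
Context {R : realType} {n : nat}.
Variables (M : smoothManifold R n) (g : tensor2 M) (u : M -> R).
Hypotheses (g_metric : pseudo_riemannian g) (su : smooth_fun u).
Implicit Types (i j : chart M) (p q : M).

Local Notation uc i := (u \o param i).
Local Notation T i j := (fun x => coord j (param i x)).

Definition chart_overlap i j : set 'rV[R]_n := coord i @` (dom i `&` dom j).

Lemma open_chart_image i : open (chart_image i).
Proof. exact: coord_open. Qed.

(** The overlap is the preimage of [dom j] under [param i] within the chart image; that image is
    open, so continuity within it is enough. *)
Lemma open_chart_overlap i j : open (chart_overlap i j).
Proof.
have -> : chart_overlap i j = chart_image i `&` (param i @^-1` dom j).
  apply/seteqP; split=> [x [p [pi pj] <-]|x [[p pi <-]]].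
    by split; [exists p|rewrite /preimage /= coordK].
  by rewrite /preimage /= coordK// => pj; exists p.
rewrite openE => x [Vx xj].
have nV : nbhs x (chart_image i) := open_nbhs_nbhs (conj (@open_chart_image i) Vx).
have := @param_continuous _ _ M i.
rewrite (continuous_open_subspace _ (@coord_open _ _ M i)).
move=> /(_ x); rewrite inE => /(_ Vx) cx.
exact: filterI nV (cx _ (open_nbhs_nbhs (conj (@dom_open _ _ M j) xj))).
Qed.

Lemma diff_transition i j x : chart_overlap i j x -> differentiable (T i j) x.
Proof.
move=> Ox; apply: differentiable_row => k.
exact: (@transition_smooth _ _ M i j k [::] x Ox).
Qed.

Lemma partial_transition (f : 'rV[R]_n -> R) i j p a : dom i p -> dom j p ->
  differentiable f (coord j p) ->
  partial a (fun y => f (coord j (param i y))) (coord i p)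
  = \sum_k jacobian (T i j) (coord i p) a k * partial k f (coord j p).
Proof.
move=> pi pj df; have Ox : chart_overlap i j (coord i p) by exists p.
have E : coord j (param i (coord i p)) = coord j p by rewrite coordK.
have df' : differentiable f (coord j (param i (coord i p))) by rewrite E.
rewrite (partial_jacobian a (diff_transition Ox) df').
by apply: eq_bigr => k _ /=; rewrite E.
Qed.

Lemma metric_smooth i : smooth_mx (chart_image i) (g i).
Proof. by move=> a b; exact: g_metric.1.1. Qed.

Lemma metric_tr i y : chart_image i y -> (g i y)^T = g i y.
Proof. by move=> Vy; have [] := g_metric.2 i y Vy. Qed.

Lemma metric_unit i y : chart_image i y -> g i y \in unitmx.
Proof. by move=> Vy; have [] := g_metric.2 i y Vy. Qed.

Lemma in_chart_image i p : dom i p -> chart_image i (coord i p).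
Proof. by move=> pi; exists p. Qed.

Lemma dcov_transition i j p a : dom i p -> dom j p ->
  dcov (uc i) (coord i p) a
  = \sum_k jacobian (T i j) (coord i p) a k * dcov (uc j) (coord j p) k.
Proof.
move=> pi pj; rewrite dcov.unlock -(partial_transition a pi pj).
  apply: (partial_ext _ (@open_chart_overlap i j)); first by exists p.
  by move=> _ [q [qi qj] <-] /=; rewrite !coordK.
exact: (smooth_on_diff (@su j) (in_chart_image pj)).
Qed.

Lemma grad_sq_transition i j p : dom i p -> dom j p ->
  grad_sq (g i) (uc i) (coord i p) = grad_sq (g j) (uc j) (coord j p).
Proof.
move=> pi pj; rewrite !grad_sqE; congr (fun_of_matrix _ 0 0).
apply: (sq_norm_congruence (J := jacobian (T i j) (coord i p))).
- exact/metric_unit/in_chart_image.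
- exact: g_metric.1.2.
apply/rowP => a; rewrite !mxE (dcov_transition a pi pj).
by apply: eq_bigr => k _; rewrite [X in X * _ = _]/= mulrC !mxE.
Qed.

Lemma partial_grad_sq_transition i j p a : dom i p -> dom j p ->
  partial a (grad_sq (g i) (uc i)) (coord i p)
  = \sum_k jacobian (T i j) (coord i p) a k
      * partial k (grad_sq (g j) (uc j)) (coord j p).
Proof.
move=> pi pj; rewrite -(partial_transition a pi pj).
  apply: (partial_ext _ (@open_chart_overlap i j)); first by exists p.
  by move=> _ [q [qi qj] <-]; rewrite coordK// (grad_sq_transition qi qj).
apply: (smooth_on_diff _ (in_chart_image pj)).
apply: smooth_grad_sq; [exact: open_chart_image|exact: metric_smooth|exact: su|].
exact: metric_unit.
Qed.

End ChartIndependence.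

(** * Constancy of xi u on the manifold and the eigenvalue equation *)

Section ConformalSolitons.
Context {R : realType} {n : nat}.
Variables (M : smoothManifold R n) (g Y : tensor2 M) (u : M -> R) (L lam : R).
Hypotheses (n_ge3 : (3 <= n)%N) (g_metric : pseudo_riemannian g).
Hypothesis Y_cky : conformal_killing_yano g Y.
Hypothesis ricg : forall (i : chart M) x, chart_image i x ->
  ricci (g i) x = L *: g i x.
Hypothesis rs : cky_rs g Y u lam.
Implicit Types (i j : chart M) (p q : M).

Local Notation uc i := (u \o param i).
Local Notation S i := (lie_fun (cky_field g Y i) (uc i)).

Let oV i : open (chart_image i) := @open_chart_image R n M i.
Let sg i : smooth_mx (chart_image i) (g i) := @metric_smooth R n M g g_metric i.
Let gT i := @metric_tr R n M g g_metric i.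
Let gu i := @metric_unit R n M g g_metric i.
Let su i : smooth_on (chart_image i) (uc i) := rs.1 i.
Let sY i : smooth_mx (chart_image i) (Y i) := Y_cky.1.1.1 i.

Let sxi i c : smooth_on (chart_image i) (fun y => cky_field g Y i y 0 c).
Proof.
exact: (smooth_sharp (@oV i) (@sg i) (@gu i)
  (smooth_cky_covector (@oV i) (@sg i) (@sY i) (@gu i))).
Qed.

Lemma cky_field_killing i y : chart_image i y ->
  lie_tensor2 (cky_field g Y i) (g i) y = 0.
Proof.
move=> Vy; apply/matrixP => a b; rewrite [RHS]mxE.
rewrite (lie_metric_sharp (@oV i) (@sg i) (@gT i) (@gu i)
  (smooth_cky_covector (@oV i) (@sg i) (@sY i) (@gu i)))//.
apply: (cky_covector_killing (@oV i) (@sg i) (@sY i) (@gT i) (@gu i) _ n_ge3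
  (@ricg i) _ a b Vy).
  by move=> z Vz; exact: Y_cky.1.2.
by move=> z Vz; exact: Y_cky.2.
Qed.

Lemma partial_lie_fun_chart i y c : chart_image i y -> partial c (S i) y = 0.
Proof.
move=> Vy; apply: (partial_lie_fun (@oV i) (@sg i) (@su i) (@gT i) (@gu i) n_ge3
  (@sxi i) (@ricg i) (@cky_field_killing i) (rs.2 i) c Vy).
Qed.

Lemma lie_fun_chart_indep i j p : dom i p -> dom j p ->
  S i (coord i p) = S j (coord j p).
Proof.
move=> pi pj; set xi := coord i p; set xj := coord j p.
have Vi : chart_image i xi by exact: in_chart_image.
have Vj : chart_image j xj by exact: in_chart_image.
have [[a ua]|u0] := pselect (exists a, dcov (uc i) xi a != 0); last first.
  have ui a : dcov (uc i) xi a = 0.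
    by apply/eqP/negPn/negP => ua; apply: u0; exists a.
  have uj a : dcov (uc j) xj a = 0.
    rewrite (dcov_transition rs.1 a pj pi) big1// => k _.
    by rewrite ui mulr0.
  by rewrite !lie_fun_grad0.
pose chi k := hess_trace (g k) (uc k) (cky_field g Y k) L lam.
have dN k x c : chart_image k x -> partial c (grad_sq (g k) (uc k)) x
    = 2 * (grad_sq (g k) (uc k) x + chi k x) * dcov (uc k) x c.
  exact: (partial_grad_sq (@oV k) (@sg k) (@su k) (@gT k) (@gu k) n_ge3
    (@ricg k) (@cky_field_killing k) (rs.2 k) c).
have WE k x : chart_image k x -> soliton_defect (uc k) (cky_field g Y k) lam x
    = (n%:R * 2 - 2) * chi k x + (n%:R - 1) * grad_sq (g k) (uc k) x - L.
  exact: (soliton_defectE (@oV k) (@sg k) (@su k) (@gT k) (@gu k) n_ge3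
    (@ricg k) (@cky_field_killing k) (rs.2 k)).
have NE := grad_sq_transition g_metric rs.1 pi pj.
(* The law for the differential of the squared norm is compared in both charts along the coordinate
   [a], where the component of du is nonzero and can be divided out. *)
have chiE : chi i xi = chi j xj.
  have := partial_grad_sq_transition g_metric rs.1 a pi pj.
  rewrite dN// NE; under eq_bigr do rewrite dN// mulrCA.
  rewrite -mulr_sumr -(dcov_transition rs.1 a pi pj) => /(mulIf ua).
  by move=> /(mulfI (lt0r_neq0 (ltr0Sn R 1))) /addrI.
have := WE i xi Vi; rewrite chiE NE -(WE j xj Vj) /soliton_defect.
have -> : uc i xi = uc j xj by rewrite /= !coordK.
by move=> /(mulIf (lt0r_neq0 (expR_gt0 _))) /addIr.
Qed.

Lemma lie_fun_constant (M_connected : connected [set: M]) :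
  exists k, forall i p, dom i p -> S i (coord i p) = k.
Proof.
(* The empty manifold is connected in this sense, and any constant serves there. *)
have [[p0 _]|noM] := pselect (exists p : M, True); last first.
  by exists 0 => i p; exfalso; apply: noM; exists p.
pose ci p := projT1 (cid (dom_cover p)).
have cP p : dom (ci p) p := projT2 (cid (dom_cover p)).
pose k p := S (ci p) (coord (ci p) p).
have kE i p : dom i p -> S i (coord i p) = k p.
  by move=> pi; exact: lie_fun_chart_indep.
have kloc p : \forall q \near p, k q = k p.
  set i := ci p; have pi : dom i p := cP p.
  have Vp := in_chart_image pi.
  have dS y : chart_image i y -> differentiable (S i) y.
    exact: smooth_on_diff (smooth_lie_fun (@oV i) (@su i) (@sxi i)).
  have nS := near_const_of_partial0 (@oV i) Vp dS
    (fun a y => @partial_lie_fun_chart i y a).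
  have := @coord_continuous _ _ M i.
  rewrite (continuous_open_subspace _ (@dom_open _ _ M i)) => /(_ p).
  rewrite inE => /(_ pi) /(_ _ nS) nq.
  have nd := open_nbhs_nbhs (conj (@dom_open _ _ M i) pi).
  by apply: filterS2 nd nq => q qi [_ /= E]; rewrite -(kE i q qi) E.
(* Local constancy of [k] makes this level set and its complement open. *)
pose B := [set p | k p = k p0].
have oB : open B.
  rewrite openE => p /= kp; have := kloc p; rewrite kp.
  by apply: filterS.
have cB : closed B.
  rewrite -openC openE => p /= kp; have := kloc p.
  by apply: filterS => q kq Bq; apply: kp; exact: etrans (esym kq) Bq.
have BT : B = setT.
  apply: M_connected; first by exists p0.
  - by exists B => //; rewrite setTI.
  - by exists B => //; rewrite setTI.
exists (k p0) => i p pi; rewrite (kE i p pi).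
by have : B p by rewrite BT.
Qed.

Lemma lie_eigen_exp : connected [set: M] ->
  exists alpha : R,
    lie_eigen (cky_field g Y) (fun p : M => expR (- u p)) alpha.
Proof.
(* The chain rule gives xi(e^(-u)) = -(xi u) e^(-u), hence the sign of the eigenvalue. *)
move=> /lie_fun_constant[k kE]; exists (- k) => i p pi.
rewrite -(kE i p pi) /lie_fun mulNr -mulrN mulr_suml.
apply: eq_bigr => c _; rewrite -mulrA; congr (_ * _).
have du := smooth_on_diff (@su i) (in_chart_image pi).
have dNu := differentiableN du.
rewrite (partial_comp c dNu (@derivable_expR R _)) derive1E derive_val.
rewrite (partialN c du).
have -> : (- uc i) (coord i p) = - u p.
  by rewrite -[LHS]/(- u (param i (coord i p))) coordK.
by rewrite !mulrN mulrC.
Qed.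

End ConformalSolitons.

Lemma smooth_fun_exp_opp (R : realType) n (M : smoothManifold R n) (u : M -> R) :
  smooth_fun u -> smooth_fun (fun p : M => expR (- u p)).
Proof.
move=> su i; apply: smooth_on_exp; first exact: open_chart_image.
by apply: smooth_onN; [exact: open_chart_image|exact: su].
Qed.

Theorem mainTheorem4 (R : realType) (n : nat) (n_ge3 : (3 <= n)%N)
    (M : smoothManifold R n) (M_connected : connected [set: M])
    (g : tensor2 M) (g_metric : pseudo_riemannian g) (g_einstein : einstein g)
    (Y : tensor2 M) (Y_cky : conformal_killing_yano g Y) :
  (forall (u : M -> R) (lambda : R),
     cky_rs g Y u lambda -> nonconstant u ->
     exists alpha : R,
       lie_eigen (cky_field g Y) (fun p : M => expR (- u p)) alpha) /\
  ((~ exists (f : M -> R) (mu : R),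
        [/\ smooth_fun f, forall p : M, 0 < f p, nonconstant f
          & lie_eigen (cky_field g Y) f mu]) ->
   ~ exists (u : M -> R) (lambda : R), cky_rs g Y u lambda /\ nonconstant u).
Proof.
have [L ricg] := g_einstein.
have eigen u lambda : cky_rs g Y u lambda -> exists alpha : R,
    lie_eigen (cky_field g Y) (fun p : M => expR (- u p)) alpha.
  by move=> rs; exact: (lie_eigen_exp n_ge3 g_metric Y_cky ricg rs M_connected).
split=> [u lambda rs _|noeig [u [lambda [rs u_nc]]]]; first exact: eigen rs.
have [alpha E] := eigen _ _ rs.
apply: noeig; exists (fun p => expR (- u p)), alpha; split=> //.
- exact: smooth_fun_exp_opp rs.1.
- by move=> p; exact: expR_gt0.
move=> [c cE]; apply: u_nc; exists (- ln c) => p.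
by rewrite -(cE p) expRK opprK.
Qed.
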